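(* Let $G$ be a connected 3-dimensional Lie group endowed with a left-invariant Riemannian metric, and let $\mathfrak g$ be its Lie algebra. Then $G$ admits a non-zero invariant Ricci Killing spinor if and only if one of the following holds: 1. $\mathfrak g$ is commutative. In this case, every non-zero invariant spinor is parallel and thus a Ricci Killing spinor. 2. $\mathfrak g\cong\mathfrak{su}(2)$ and the Milnor constants satisfy $\lambda_1=\lambda_2=\lambda_3=:\lambda\ne0$. In this case, every non-zero invariant spinor is a Ricci Killing spinor with constant $\mu=\frac1{2\lambda}$ and is a Killing spinor with Killing number $\frac\lambda4$. 3. $\mathfrak g\cong\mathfrak{heis}_3$ (the 3-dimensional Heisenberg Lie algebra). In this case, every non-zero invariant spinor is a Ricci Killing spinor which is not a Killing spinor.
   Context: Fix an orientation of $G$ and a positively oriented orthonormal basis of $\mathfrak g$; left translation gives a global positively oriented orthonormal frame and a trivialization $P_{\mathrm{SO}}G\cong G\times\mathrm{SO}(3)$. $G$ carries the spin structure $G\times\mathrm{Spin}(3)\to G\times\mathrm{SO}(3)$, $(x,s)\mapsto(x,\pi(s))$, with $\pi$ the standard double covering, so the complex spinor bundle is $\Sigma G\cong G\times\Sigma_3$ with $\Sigma_3\cong\mathbb{C}^2$ the spinor module. An invariant spinor is a spinor field that is constant in this trivialization. Clifford multiplication satisfies $X\cdot Y\cdot+Y\cdot X\cdot=-2g(X,Y)$ and is chosen so that for a positive orthonormal frame $e_1\cdot e_2\cdot=e_3\cdot$ (equivalently, the complex volume element $i^2e_1\cdot e_2\cdot e_3$ acts as $\mathrm{Id}$). $\nabla$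 denotes the spin connection induced by the Levi-Civita connection. A Ricci Killing spinor with constant $\mu\in\mathbb{R}\setminus\{0\}$ is a non-zero spinor field $\psi$ with $\nabla_X\psi=\mu\,\mathrm{Ric}(X)\cdot\psi$ for all $X$ ($\mathrm{Ric}$ viewed as an endomorphism of $TG$). A Killing spinor with Killing number $\kappa\in\mathbb{R}$ is a non-zero spinor field with $\nabla_X\psi=\kappa X\cdot\psi$ for all $X$. If $G$ is unimodular, there is a positively oriented left-invariant orthonormal frame $(e_1,e_2,e_3)$ (a Milnor frame) with $[e_2,e_3]=\lambda_1e_1$, $[e_3,e_1]=\lambda_2e_2$, $[e_1,e_2]=\lambda_3e_3$; the real numbers $\lambda_1,\lambda_2,\lambda_3$ are the Milnor constants. *)

(* Defs.v *)
From HB Require Import structures.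
From mathcomp Require Import all_boot all_order all_algebra.
From mathcomp Require Import complex.
From mathcomp Require Import all_classical all_reals all_analysis.

Set Implicit Arguments.
Unset Strict Implicit.
Unset Printing Implicit Defensive.

Import Order.TTheory GRing.Theory Num.Theory.
Import numFieldNormedType.Exports.

Local Open Scope classical_set_scope.
Local Open Scope ring_scope.

(* No compatibility between the two structures is imposed here: continuity of
   the group operations is part of [lieGroup3]. *)
#[short(type="groupTopologicalType")]
HB.structure Definition GroupTopological := {G of Group G & Topological G}.

Section Smoothness.
Variables (R : realType) (V W : normedModType R).

(* Only meant for an open set O; f may take arbitrary values outside O. *)
Fixpoint Ck_on (k : nat) (O : set V) (f : V -> W) : Prop :=
  (forall x, O x -> continuous_at x f) /\
  if k is k'.+1 then
    (forall x v, O x -> derivable f x v) /\ (forall v, Ck_on k' O ('D_v f))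
  else True.

Definition smooth_on (O : set V) (f : V -> W) : Prop := forall k, Ck_on k O f.

End Smoothness.

(* [coord] is only relevant on [dom], and [param] (the inverse of [coord]) only
   on [coord @` dom]. *)
Record chart (R : realType) (T : Type) := Chart {
  dom : set T;
  coord : T -> 'rV[R]_3;
  param : 'rV[R]_3 -> T }.

Definition img (R : realType) (T : Type) (c : chart R T) : set 'rV[R]_3 :=
  coord c @` dom c.

Record lieGroup3 (R : realType) := LieGroup3 {
  carrier :> groupTopologicalType;
  atlas : set (chart R carrier);
  lie_hausdorff : hausdorff_space carrier;
  lie_second_countable : @second_countable carrier;
  atlas_cover : forall x : carrier, exists2 c, atlas c & dom c x;
  atlas_homeo : forall c, atlas c ->
    [/\ open (dom c), open (img c),
        forall x, dom c x -> param c (coord c x) = x,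
        forall x, dom c x -> continuous_at x (coord c) &
        forall p, img c p -> continuous_at p (param c)];
  atlas_smooth : forall c c', atlas c -> atlas c' ->
    smooth_on (coord c @` (dom c `&` dom c')) (coord c' \o param c);
  mul_continuous : continuous (fun z : carrier * carrier => (z.1 * z.2)%g);
  inv_continuous : continuous (fun x : carrier => (x^-1)%g);
  mul_smooth : forall c1 c2 c3, atlas c1 -> atlas c2 -> atlas c3 ->
    smooth_on
      [set p : 'rV[R]_3 * 'rV[R]_3 | [/\ img c1 p.1, img c2 p.2 &
         dom c3 (param c1 p.1 * param c2 p.2)%g]]
      (fun p => coord c3 (param c1 p.1 * param c2 p.2)%g);
  inv_smooth : forall c1 c2, atlas c1 -> atlas c2 ->
    smooth_on [set p | img c1 p /\ dom c2 ((param c1 p)^-1)%g]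
      (fun p => coord c2 ((param c1 p)^-1)%g) }.

Section LieIsomorphism.
Variables (R : realType) (V W : zmodType).

(* The Lie algebras are given as subsets A, B of ambient groups, with their
   R-scalings and brackets. *)
Definition lie_isomorphic (scV : R -> V -> V) (brV : V -> V -> V) (A : set V)
    (scW : R -> W -> W) (brW : W -> W -> W) (B : set W) : Prop :=
  exists phi : V -> W,
    [/\ set_bij A B phi,
        (forall X Y, A X -> A Y -> phi (X + Y) = phi X + phi Y),
        (forall a X, A X -> phi (scV a X) = scW a (phi X)) &
        (forall X Y, A X -> A Y -> phi (brV X Y) = brW (phi X) (phi Y))].

End LieIsomorphism.

Definition mxcomm (K : nzRingType) n (M N : 'M[K]_n) : 'M[K]_n :=
  M *m N - N *m M.

Definition su2 (R : realType) : set 'M[R[i]]_2 :=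
  [set M | map_mx conjc M^T = - M /\ \tr M = 0].

Definition heis3 (R : realType) : set 'M[R]_3 :=
  [set M | forall i j : 'I_3, (j <= i)%N -> M i j = 0].

Definition mx22 (K : Type) (a b c d : K) : 'M[K]_2 :=
  \matrix_(i, j) if i == 0 then (if j == 0 then a else b)
                 else (if j == 0 then c else d).

(* Clifford multiplication by the standard basis vectors of R^3 on the spinor
   module C^2, normalized by e_1 . e_2 = e_3. *)
Definition cliff (R : realType) (k : 'I_3) : 'M[R[i]]_2 :=
  match val k with
  | 0%N => mx22 ('i)%C 0 0 (- ('i)%C)
  | 1%N => mx22 0 1 (- 1) 0
  | _ => mx22 0 ('i)%C ('i)%C 0
  end.

Lemma cliff_anticomm (R : realType) (j k : 'I_3) :
  cliff R j *m cliff R k + cliff R k *m cliff R j = ((j == k)%:R * - 2)%:M.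
Proof.
have ii : ('i)%C * ('i)%C = -1 :> R[i] by rewrite -expr2 sqr_i.
apply/matrixP => a b; rewrite !mxE !big_ord_recl !big_ord0 /=.
case: j => [[|[|[|//]]] hj]; case: k => [[|[|[|//]]] hk]; rewrite /cliff /=;
  case: a => [[|[|//]] ha]; case: b => [[|[|//]] hb]; rewrite !mxE /=;
  rewrite -?val_eqE /= ?(mulr0, mul0r, mulr1, mul1r, addr0, add0r, mulrN, mulNr,
    opprK, ii, mulr1n, mulr0n, oppr0, subrr, addNr) //; by rewrite -opprD.
Qed.

Lemma cliff12 (R : realType) : cliff R 0 *m cliff R 1 = cliff R 2.
Proof.
apply/matrixP => a b; rewrite !mxE !big_ord_recl !big_ord0 /cliff /=.
case: a => [[|[|//]] ha]; case: b => [[|[|//]] hb]; rewrite !mxE /=;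
  by rewrite ?(mulr0, mul0r, mulr1, mul1r, addr0, add0r, mulrN, mulNr,
    opprK, oppr0).
Qed.

Section Geometry.
Variables (R : realType) (G : lieGroup3 R).

Definition smooth (f : G -> R) : Prop :=
  forall c, atlas c -> smooth_on (img c) (f \o param c).

(* A tangent vector at x is a derivation of C^oo(G) at x.  It is encoded as a
   total functional on all functions, with value 0 on the non-smooth ones, so
   that equality of tangent vectors is Leibniz equality. *)
Definition tangent (x : G) (v : (G -> R) -> R) : Prop :=
  [/\ forall f, ~ smooth f -> v f = 0,
      forall a f h, smooth f -> smooth h ->
        v (fun y => a * f y + h y) = a * v f + v h &
      forall f h, smooth f -> smooth h ->
        v (fun y => f y * h y) = f x * v h + h x * v f].

(* Type of sections (not necessarily smooth or even tangent); the actual vector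
   fields are those satisfying [vfield]. *)
Definition field : Type := G -> (G -> R) -> R.

Definition app (X : field) (f : G -> R) : G -> R := fun x => X x f.

Definition vfield (X : field) : Prop :=
  (forall x, tangent x (X x)) /\ (forall f, smooth f -> smooth (app X f)).

Definition fscale (h : G -> R) (X : field) : field := fun x f => h x * X x f.

(* For non-smooth f, [app Y f] and [app X f] vanish, hence so does the bracket. *)
Definition bracket (X Y : field) : field :=
  fun x f => X x (app Y f) - Y x (app X f).

(* Differential of the left translation by a. *)
Definition dL (a : G) (v : (G -> R) -> R) : (G -> R) -> R :=
  fun f => v (fun y => f (a * y)%g).

Definition left_invariant (X : field) : Prop :=
  forall a x, X (a * x)%g = dL a (X x).

Definition lie_algebra : set field :=
  [set X | vfield X /\ left_invariant X].

Definition commutative_algebra : Prop :=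
  forall X Y, lie_algebra X -> lie_algebra Y -> bracket X Y = 0.

Definition cscale (a : R) (X : field) : field := fscale (fun=> a) X.

Definition iso_su2 : Prop :=
  lie_isomorphic cscale bracket lie_algebra
    (fun a (M : 'M[R[i]]_2) => a%:C%C *: M) (@mxcomm R[i] 2) (@su2 R).

Definition iso_heis3 : Prop :=
  lie_isomorphic cscale bracket lie_algebra
    (fun a (M : 'M[R]_3) => a *: M) (@mxcomm R 3) (@heis3 R).

Definition metric : Type := G -> ((G -> R) -> R) -> ((G -> R) -> R) -> R.

Definition gfun (g : metric) (X Y : field) : G -> R := fun x => g x (X x) (Y x).

Definition riemannian (g : metric) : Prop :=
  [/\ forall x u v w a, tangent x u -> tangent x v -> tangent x w ->
        g x (fun f => a * u f + v f) w = a * g x u w + g x v w,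
      forall x u v, tangent x u -> tangent x v -> g x u v = g x v u,
      forall x v, tangent x v -> v <> (fun=> 0) -> 0 < g x v v &
      forall X Y, vfield X -> vfield Y -> smooth (gfun g X Y)].

Definition left_invariant_metric (g : metric) : Prop :=
  forall a x v w, tangent x v -> tangent x w ->
    g (a * x)%g (dL a v) (dL a w) = g x v w.

Definition connection (nabla : field -> field -> field) : Prop :=
  [/\ forall X Y, vfield X -> vfield Y -> vfield (nabla X Y),
      forall h X Y Z, smooth h -> vfield X -> vfield Y -> vfield Z ->
        nabla (fscale h X + Y) Z = fscale h (nabla X Z) + nabla Y Z,
      forall X Y Z, vfield X -> vfield Y -> vfield Z ->
        nabla X (Y + Z) = nabla X Y + nabla X Z &
      forall h X Y, smooth h -> vfield X -> vfield Y ->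
        nabla X (fscale h Y) = fscale (app X h) Y + fscale h (nabla X Y)].

Definition levi_civita (g : metric) (nabla : field -> field -> field) : Prop :=
  [/\ connection nabla,
      forall X Y, vfield X -> vfield Y ->
        nabla X Y - nabla Y X = bracket X Y &
      forall X Y Z, vfield X -> vfield Y -> vfield Z -> forall x,
        X x (gfun g Y Z) = gfun g (nabla X Y) Z x + gfun g Y (nabla X Z) x].

Definition curvature (nabla : field -> field -> field) (X Y Z : field) : field :=
  nabla X (nabla Y Z) - nabla Y (nabla X Z) - nabla (bracket X Y) Z.

(* A global left-invariant orthonormal frame: at each point x it is an
   orthonormal basis of the tangent space. *)
Definition left_invariant_onframe (g : metric) (e : 'I_3 -> field) : Prop :=
  [/\ forall i, lie_algebra (e i),
      forall i j x, g x (e i x) (e j x) = (i == j)%:R &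
      forall x v, tangent x v ->
        exists c : 'I_3 -> R, v = fun f => \sum_i c i * e i x f].

(* f induces the same orientation as e. *)
Definition same_orientation (g : metric) (e f : 'I_3 -> field) : Prop :=
  forall x, 0 < \det (\matrix_(i < 3, j < 3) g x (f i x) (e j x)).

(* The orientation of G is the one of the frame e. *)
Definition milnor_frame (g : metric) (e f : 'I_3 -> field) (l1 l2 l3 : R) :
    Prop :=
  [/\ left_invariant_onframe g f /\ same_orientation g e f,
      bracket (f 1) (f 2) = cscale l1 (f 0),
      bracket (f 2) (f 0) = cscale l2 (f 1) &
      bracket (f 0) (f 1) = cscale l3 (f 2)].

Section Spinors.
Variables (g : metric) (nabla : field -> field -> field) (e : 'I_3 -> field).

(* The Ricci endomorphism Ric(X) = sum_i R(X, e_i) e_i. *)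
Definition ricci (X : field) : field :=
  \sum_i curvature nabla X (e i) (e i).

(* Sections of the spinor bundle G x C^2, in the trivialization given by e. *)
Definition spinor : Type := G -> 'cV[R[i]]_2.

Definition spinor_field (psi : spinor) : Prop :=
  forall k, smooth (fun x => complex.Re (psi x k 0)) /\
            smooth (fun x => complex.Im (psi x k 0)).

Definition nonzero (psi : spinor) : Prop := exists x, psi x != 0.

Definition invariant_spinor (psi : spinor) : Prop :=
  exists s : 'cV[R[i]]_2, psi = fun=> s.

Definition deriv_spinor (X : field) (psi : spinor) : spinor :=
  fun x => \col_k (Complex (X x (fun y => complex.Re (psi y k 0)))
                           (X x (fun y => complex.Im (psi y k 0)))).

Definition clifford_mul (X : field) (psi : spinor) : spinor :=
  fun x => \sum_i (gfun g X (e i) x)%:C%C *: (cliff R i *m psi x).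

(* nabla_X psi = X(psi) + 1/4 sum_(i, j) g(nabla_X e_i, e_j) e_i . e_j . psi *)
Definition spin_nabla (X : field) (psi : spinor) : spinor :=
  fun x => deriv_spinor X psi x +
    4^-1 *: \sum_i \sum_j (gfun g (nabla X (e i)) (e j) x)%:C%C *:
              (cliff R i *m (cliff R j *m psi x)).

Definition parallel (psi : spinor) : Prop :=
  spinor_field psi /\ forall X, vfield X -> forall x, spin_nabla X psi x = 0.

Definition ricci_killing_with (mu : R) (psi : spinor) : Prop :=
  [/\ spinor_field psi, nonzero psi, mu != 0 &
      forall X, vfield X -> forall x,
        spin_nabla X psi x = mu%:C%C *: clifford_mul (ricci X) psi x].

Definition ricci_killing (psi : spinor) : Prop :=
  exists mu, ricci_killing_with mu psi.

Definition killing_with (kappa : R) (psi : spinor) : Prop :=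
  [/\ spinor_field psi, nonzero psi &
      forall X, vfield X -> forall x,
        spin_nabla X psi x = kappa%:C%C *: clifford_mul X psi x].

Definition killing (psi : spinor) : Prop := exists kappa, killing_with kappa psi.

End Spinors.

End Geometry.

(* Main.v *)
Require Import Defs.
From mathcomp Require Import all_boot all_order all_algebra.
From mathcomp Require Import complex ring lra.
From mathcomp Require Import all_classical all_reals all_analysis.

Set Implicit Arguments.
Unset Strict Implicit.
Unset Printing Implicit Defensive.

Import Order.TTheory GRing.Theory Num.Theory.
Import numFieldNormedType.Exports.
Local Open Scope classical_set_scope.
Local Open Scope ring_scope.

(** Everything reduces to linear algebra in the given left-invariant orthonormal
frame (e_0, e_1, e_2).  Indices are taken in Z/3, so that e_(l+1) x e_(l+2) = e_l.
The Lie bracket is then encoded by a 3 x 3 matrix M, [e_(l+1), e_(l+2)] =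
sum_k M_lk e_k ([cross_mx]), and the Levi-Civita connection by the matrix W with
nabla_(e_k) Y = (sum_l W_kl e_l) x Y for left-invariant Y ([conn_mx]).  The
Koszul formula gives W = (tr M / 2) I - M^T.

On an invariant spinor s the spin derivative is nabla_X s = 1/2 W(X) . s, because
e_0 . e_1 = e_2 turns the skew form g(nabla_X e_i, e_j) into Clifford
multiplication by the corresponding vector.  A nonzero spinor is killed by
Clifford multiplication by a only if a = 0, since a . a = - |a|^2.  Hence all
equations considered here are matrix equations, independent of s
([killing_equation]): s is a Ricci Killing spinor with constant mu iff
W = 2 mu Ric, and a Killing spinor with number kappa iff W = 2 kappa I.

The Jacobi identity makes Ric symmetric, so W = 2 mu Ric forces W, and then M, to
be symmetric; in particular G is unimodular.  For symmetric W one has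
Ric = 2 adj W, so that W = m adj W with m = 4 mu and W^2 = m det(W) I.
Comparing entries, (1 + m tr W) times the non-scalar part of W is 0
([adjugate_equation]).  Either W is scalar, and then M = t I (the commutative
algebra for t = 0, su(2) otherwise), or m tr W = -1, and then all 2 x 2 minors of
M vanish, so that M = t z z^T has rank one: the bracket is
[X, Y] = t <z, X x Y> z, which is the Heisenberg algebra
([ricci_killing_classification]).

Conversely, M = 0 gives W = Ric = 0; M = t I gives W = t/2 I and Ric = t^2/2 I;
M = t z z^T gives Ric = - t |z|^2 W, where W is not scalar.  It remains to
translate between M and the conditions on the Lie algebra: M = t I says that the
bracket is t times the cross product, which does not depend on the positive
orthonormal frame ([scalar_of_milnor_frame]), and an isomorphism with heis_3
forces M to have rank one because its derived algebra is a central line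
([rank1_of_iso_heis3]).

Tangent vectors are derivations of the algebra of all smooth functions on G.  The
tangent spaces are spanned by the frame by assumption, so bump functions never
enter: the geometry only uses that smooth functions form an algebra and that the
scalar products with the frame are smooth. *)

Local Notation cscale := Defs.cscale.

(** * Closure properties of smooth functions and of vector fields *)

Section CkClosure.
Variables (R : realType) (V : normedModType R).
Implicit Types (O : set V) (f h : V -> R).

(** Openness of the domain matters: the condition on the derivatives at a point
only sees the values of the function near that point. *)
Lemma Ck_on_ext k O f h : open O -> (forall x, O x -> f x = h x) ->
  Ck_on k O f -> Ck_on k O h.
Proof.
move=> openO; elim: k f h => [|k IH] f h fh /= [cf kf].
all: have near_fh x : O x -> \near x, f x = h x
  by move=> Ox; apply: filterS (open_nbhs_nbhs (conj openO Ox)).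
all: have ch x : O x -> continuous_at x h
  by move=> Ox; rewrite /continuous_at -(fh x Ox);
     apply: cvg_trans (cf x Ox); apply: near_eq_cvg; exact: near_fh.
all: split=> //.
case: kf => df Dkf; split=> [x v Ox|v].
  by apply: near_eq_derivable (df x v Ox); exact: near_fh.
by apply: IH (Dkf v) => x Ox; apply: near_eq_derive; exact: near_fh.
Qed.

Lemma Ck_onS k O f : Ck_on k.+1 O f -> Ck_on k O f.
Proof.
elim: k f => [|k IH] f [cf [df Df]]; first by split.
by split=> //; split=> // v; apply: IH.
Qed.

Lemma Ck_on_cst k O (a : R) : open O -> Ck_on k O (fun=> a).
Proof.
move=> openO; elim: k a => [|k IH] a; split=> //.
1,2: by move=> x _; exact: cvg_cst.
split=> [x v _|v]; first exact: derivable_cst.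
apply: (@Ck_on_ext _ _ (fun=> 0)) (IH 0) => // x _.
by rewrite (derive_cst a x v).
Qed.

Lemma Ck_onD k O f h : open O -> Ck_on k O f -> Ck_on k O h ->
  Ck_on k O (fun x => f x + h x).
Proof.
move=> openO; elim: k f h => [|k IH] f h [cf kf] [ch kh]; split=> //.
1,2: by move=> x Ox; exact: (continuousD (cf x Ox) (ch x Ox)).
case: kf kh => [df Df] [dh Dh]; split=> [x v Ox|v].
  exact: (derivableD (df x v Ox) (dh x v Ox)).
apply: (@Ck_on_ext _ _ (fun x => 'D_v f x + 'D_v h x)) (IH _ _ (Df v) (Dh v)) =>
  // x Ox.
by rewrite (deriveD (df x v Ox) (dh x v Ox)).
Qed.

Lemma Ck_onM k O f h : open O -> Ck_on k O f -> Ck_on k O h ->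
  Ck_on k O (fun x => f x * h x).
Proof.
move=> openO; elim: k f h => [|k IH] f h Cf Ch;
  have [cf kf] := Cf; have [ch kh] := Ch; split=> //.
1,2: by move=> x Ox; exact: (continuousM (cf x Ox) (ch x Ox)).
case: kf kh => [df Df] [dh Dh]; split=> [x v Ox|v].
  exact: (derivableM (df x v Ox) (dh x v Ox)).
apply: (@Ck_on_ext _ _ (fun x => f x * 'D_v h x + h x * 'D_v f x)) => //.
  by move=> x Ox; rewrite (deriveM (df x v Ox) (dh x v Ox)).
by apply: (Ck_onD openO (IH _ _ (Ck_onS Cf) (Dh v)) (IH _ _ (Ck_onS Ch) (Df v))).
Qed.

End CkClosure.

Section SmoothFunctions.
Variables (R : realType) (G : lieGroup3 R).
Implicit Types f h : G -> R.

Lemma open_img (c : chart R G) : atlas c -> open (img c).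
Proof. by case/atlas_homeo. Qed.

Lemma smooth_cst (a : R) : smooth (fun _ : G => a).
Proof. by move=> c /open_img oc k; exact: Ck_on_cst. Qed.

Lemma smoothD f h : smooth f -> smooth h -> smooth (fun x => f x + h x).
Proof.
move=> sf sh c ac k; apply: Ck_onD (sf c ac k) (sh c ac k); exact: open_img.
Qed.

Lemma smoothM f h : smooth f -> smooth h -> smooth (fun x => f x * h x).
Proof.
move=> sf sh c ac k; apply: Ck_onM (sf c ac k) (sh c ac k); exact: open_img.
Qed.

Lemma smoothZ a f : smooth f -> smooth (fun x => a * f x).
Proof. by apply: smoothM; exact: smooth_cst. Qed.

Lemma smoothB f h : smooth f -> smooth h -> smooth (fun x => f x - h x).
Proof.
move=> sf sh; have -> : (fun x => f x - h x) = (fun x => f x + -1 * h x).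
  by apply/funext => x; rewrite mulN1r.
by apply: smoothD => //; exact: smoothZ.
Qed.

End SmoothFunctions.

Section Tangents.
Variables (R : realType) (G : lieGroup3 R) (x : G) (v : (G -> R) -> R).
Hypothesis tv : tangent x v.
Implicit Types f h : G -> R.

Lemma tangentD f h : smooth f -> smooth h ->
  v (fun y => f y + h y) = v f + v h.
Proof.
case: tv => _ lin _ sf sh; have := lin 1 f h sf sh; rewrite mul1r => <-.
by congr v; apply/funext => y; rewrite mul1r.
Qed.

Lemma tangentM f h : smooth f -> smooth h ->
  v (fun y => f y * h y) = f x * v h + h x * v f.
Proof. by case: tv => _ _; apply. Qed.

(** Leibniz on 1 * 1 = 1 forces v 1 = 2 v 1. *)
Lemma tangent_cst a : v (fun=> a) = 0.
Proof.
have one : v (fun=> 1) = 0.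
  have s1 := smooth_cst (1 : R) (G := G).
  have := tangentM s1 s1.
  rewrite mulr1; lra.
have zero : v (fun=> 0) = 0.
  have s0 := smooth_cst (0 : R) (G := G).
  have := tangentD s0 s0.
  rewrite addr0; lra.
case: tv => _ lin _; have := lin a _ _ (smooth_cst 1) (smooth_cst 0).
by rewrite one zero mulr1 mulr0 !addr0.
Qed.

Lemma tangentZ a f : smooth f -> v (fun y => a * f y) = a * v f.
Proof.
move=> sf; rewrite tangentM //; last exact: smooth_cst.
by rewrite tangent_cst mulr0 addr0.
Qed.

Lemma tangentB f h : smooth f -> smooth h ->
  v (fun y => f y - h y) = v f - v h.
Proof.
move=> sf sh; have -> : (fun x => f x - h x) = (fun x => f x + -1 * h x).
  by apply/funext => y; rewrite mulN1r.
by rewrite tangentD ?tangentZ ?mulN1r //; exact: smoothZ.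
Qed.

Lemma tangent_lincomb a (u : (G -> R) -> R) : tangent x u ->
  tangent x (fun f => a * v f + u f).
Proof.
case: tv => nv lv mv [nu lu mu]; split=> [f nf|b f h sf sh|f h sf sh].
- by rewrite nv // nu // mulr0 addr0.
- by rewrite lv // lu //; ring.
- by rewrite mv // mu //; ring.
Qed.

End Tangents.

Section VectorFields.
Variables (R : realType) (G : lieGroup3 R).
Implicit Types (X Y Z : field G) (f h : G -> R).

Lemma vfield_tangent X x : vfield X -> tangent x (X x).
Proof. by case. Qed.

Lemma vfield_nonsmooth X f x : vfield X -> ~ smooth f -> X x f = 0.
Proof. by case=> /(_ x)[nX _ _] _ nf; exact: nX. Qed.

Lemma vfield_smooth X f : vfield X -> smooth f -> smooth (fun x => X x f).
Proof. by case=> _; apply. Qed.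

Lemma tangent0 (x : G) : tangent x (fun=> 0 : R).
Proof. by split=> // *; rewrite !mulr0 addr0. Qed.

Lemma vfield_lincomb h X Y : smooth h -> vfield X -> vfield Y ->
  vfield (fscale h X + Y).
Proof.
move=> sh [tX sX] [tY sY]; split=> [x|f sf].
  exact: (tangent_lincomb (tX x) (h x) (tY x)).
by apply: (smoothD (smoothM sh (sX f sf)) (sY f sf)).
Qed.

Lemma vfield0 : vfield (0 : field G).
Proof. by split=> [x|f sf]; [exact: tangent0|exact: smooth_cst]. Qed.

Lemma vfield_fscale h X : smooth h -> vfield X -> vfield (fscale h X).
Proof.
by move=> sh vX; rewrite -[fscale h X]addr0; apply: vfield_lincomb vfield0.
Qed.

Lemma fscale1 X : fscale (fun=> 1) X = X.
Proof. by apply/funext => x; apply/funext => f; rewrite /fscale mul1r. Qed.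

Lemma vfieldD X Y : vfield X -> vfield Y -> vfield (X + Y).
Proof.
move=> vX vY; rewrite -(fscale1 X); apply: vfield_lincomb => //.
exact: smooth_cst.
Qed.

Lemma vfield_sum (F : 'I_3 -> field G) :
  (forall i, vfield (F i)) -> vfield (\sum_i F i).
Proof. by move=> vF; elim/big_ind: _ => //; [exact: vfield0|exact: vfieldD]. Qed.

(** The second-order terms of X Y and Y X applied to a product cancel. *)
Lemma vfield_bracket X Y : vfield X -> vfield Y -> vfield (bracket X Y).
Proof.
move=> vX vY; split=> [x|f sf]; last first.
  exact: (smoothB (vfield_smooth vX (vfield_smooth vY sf))
                  (vfield_smooth vY (vfield_smooth vX sf))).
have tX := vfield_tangent x vX; have tY := vfield_tangent x vY.
split=> [f nf|a f h sf sh|f h sf sh].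
- rewrite /bracket /app; under eq_fun do rewrite vfield_nonsmooth//.
  rewrite (tangent_cst tX).
  by under eq_fun do rewrite vfield_nonsmooth//; rewrite (tangent_cst tY) subr0.
- have key Z W : vfield Z -> vfield W ->
    Z x (app W (fun y => a * f y + h y)) = a * Z x (app W f) + Z x (app W h).
    move=> vZ vW; have -> : app W (fun y => a * f y + h y) =
        (fun y => a * app W f y + app W h y).
      by apply/funext => y; case: (vfield_tangent y vW) => _ + _; apply.
    by case: (vfield_tangent x vZ) => _ + _; apply; apply: vfield_smooth.
  by rewrite /bracket !key //; ring.
- have key Z W : vfield Z -> vfield W ->
    Z x (app W (fun y => f y * h y)) =
    f x * Z x (app W h) + h x * Z x (app W f) + W x h * Z x f + W x f * Z x h.
    move=> vZ vW; have -> : app W (fun y => f y * h y) =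
        (fun y => f y * app W h y + h y * app W f y).
      by apply/funext => y; rewrite /app (tangentM (vfield_tangent y vW)).
    have tZ := vfield_tangent x vZ.
    have sWh : smooth (app W h) by exact: vfield_smooth.
    have sWf : smooth (app W f) by exact: vfield_smooth.
    rewrite (tangentD tZ) ?(tangentM tZ) //; try exact: smoothM.
    by rewrite /app; ring.
  by rewrite /bracket !key //; ring.
Qed.

Lemma bracket_skew X Y : bracket X Y = - bracket Y X.
Proof.
by apply/funext => x; apply/funext => f; rewrite /bracket !fctE opprB.
Qed.

(** The term in the derivative of h makes the bracket non-tensorial; in the
curvature it is what compensates the derivative of h along Z. *)
Lemma bracket_lincomb h X Y Z : smooth h -> vfield X -> vfield Y -> vfield Z ->
  bracket (fscale h X + Y) Z =
  fscale h (bracket X Z) + fscale (fun x => - Z x h) X + bracket Y Z.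
Proof.
move=> sh vX vY vZ; apply/funext => x; apply/funext => f.
have [sf|nf] := pselect (smooth f); last first.
  rewrite [LHS]vfield_nonsmooth //; last first.
    by apply: vfield_bracket => //; exact: vfield_lincomb.
  rewrite !fctE /fscale (vfield_nonsmooth x vX nf).
  rewrite !(vfield_nonsmooth x (vfield_bracket _ _) nf) //; ring.
rewrite /bracket !fctE /fscale.
have tZ := vfield_tangent x vZ.
have -> : app (fun y f => h y * X y f + Y y f) f =
   (fun y => h y * app X f y + app Y f y) by [].
have sX : smooth (app X f) by exact: vfield_smooth.
have sY : smooth (app Y f) by exact: vfield_smooth.
rewrite (tangentD tZ) ?(tangentM tZ) //; try exact: smoothM.
by rewrite /app; ring.
Qed.

Lemma jacobi X Y Z : vfield X -> vfield Y -> vfield Z ->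
  bracket X (bracket Y Z) + bracket Y (bracket Z X) + bracket Z (bracket X Y) = 0.
Proof.
move=> vX vY vZ; apply/funext => x; apply/funext => f; rewrite !fctE.
have [sf|nf] := pselect (smooth f); last first.
  by rewrite !(vfield_nonsmooth x (vfield_bracket _ (vfield_bracket _ _)) nf) //
    !addr0.
have key A B C : vfield A -> vfield B -> vfield C ->
  bracket A (bracket B C) x f = A x (app B (app C f)) - A x (app C (app B f))
    - (B x (app C (app A f)) - C x (app B (app A f))).
  move=> vA vB vC; rewrite /bracket; congr (_ - _).
  exact: (tangentB (vfield_tangent x vA)
    (vfield_smooth vB (vfield_smooth vC sf))
    (vfield_smooth vC (vfield_smooth vB sf))).
by rewrite !key // -[RHS]/(0 : R); ring.
Qed.

End VectorFields.

(** * Algebra of the structure constants of a three-dimensional Lie algebra *)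

Section FiniteSums.

Lemma ord3E (i : 'I_3) : [\/ i = 0, i = 1 | i = 2].
Proof.
by case: i => [[|[|[|//]]] hi]; [constructor 1|constructor 2|constructor 3];
  apply/val_inj.
Qed.

(** The index set 'I_3 carries the additive group of Z/3, so that the cross product
and all cyclic formulas are written with l + 1 and l + 2. *)
Lemma ord3D : ((0 : 'I_3) + 1 = 1) * ((0 : 'I_3) + 2 = 2) * ((1 : 'I_3) + 1 = 2)
  * ((1 : 'I_3) + 2 = 0) * ((2 : 'I_3) + 1 = 0) * ((2 : 'I_3) + 2 = 1).
Proof. by do ! split; apply/val_inj. Qed.

Lemma ord3_eqE : ((0 : 'I_3) == 1 = false) * ((0 : 'I_3) == 2 = false)
  * ((1 : 'I_3) == 0 = false)
  * ((1 : 'I_3) == 2 = false) * ((2 : 'I_3) == 0 = false) * ((2 : 'I_3) == 1 = false).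
Proof. by []. Qed.

Lemma sum3E (V : nmodType) (F : 'I_3 -> V) : \sum_i F i = F 0 + F 1 + F 2.
Proof.
rewrite !big_ord_recl big_ord0 addr0 addrA.
by congr (_ + F _ + F _); apply/val_inj.
Qed.

Lemma det_mx33 (R : comNzRingType) (A : 'M[R]_3) : \det A =
  A 0 0 * (A 1 1 * A 2 2 - A 1 2 * A 2 1) + A 0 1 * (A 1 2 * A 2 0 - A 1 0 * A 2 2)
  + A 0 2 * (A 1 0 * A 2 1 - A 1 1 * A 2 0).
Proof.
pose F (i j : nat) : R := A (inord i) (inord j).
have AE i j : A i j = F i j by rewrite /F !inord_val.
rewrite (expand_det_row _ ord0) !big_ord_recl big_ord0 /cofactor.
rewrite !(expand_det_row _ ord0) !big_ord_recl !big_ord0 /cofactor !det_mx11.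
rewrite !mxE !AE /=.
rewrite /bump /=; ring.
Qed.

End FiniteSums.

Section StructureConstants.
Variables (R : realFieldType) (c : 'I_3 -> 'I_3 -> 'I_3 -> R).

(** The coefficients g(nabla_(e_i) e_j, e_k) of the Levi-Civita connection when the
scalar products of the frame are constant and c gives the brackets. *)
Definition koszul (i j k : 'I_3) : R := (c i j k - c j k i + c k i j) / 2.

(** The component along e_j of Ric(e_k) = sum_i R(e_k, e_i) e_i, with each
covariant derivative expanded in the frame. *)
Definition koszul_ricci (k j : 'I_3) : R :=
  \sum_i \sum_m (koszul i i m * koszul k m j
     - koszul k i m * koszul i m j - c k i m * koszul m i j).

(** In dimension 3 a skew bilinear map is a linear map applied to the cross
product: this is the matrix of that linear map. *)
Definition cross_mx (l k : 'I_3) : R := c (l + 1) (l + 2) k.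

(** Row k is the vector whose cross product with a left-invariant Y is
nabla_(e_k) Y. *)
Definition conn_mx (k l : 'I_3) : R := koszul k (l + 1) (l + 2).

Hypothesis c_skew : forall i j k, c i j k = - c j i k.

Local Notation M := cross_mx.

Lemma struct_cst_diag i k : c i i k = 0.
Proof. by have := c_skew i i k; lra. Qed.

Lemma struct_cst_cross : (forall k, c 0 1 k = M 2 k) * (forall k, c 1 2 k = M 0 k)
  * (forall k, c 2 0 k = M 1 k) * (forall k, c 1 0 k = - M 2 k)
  * (forall k, c 2 1 k = - M 0 k) * (forall k, c 0 2 k = - M 1 k)
  * (forall i k, c i i k = 0).
Proof.
have h i j k := c_skew i j k.
by do ! split; move=> *; rewrite /cross_mx ?ord3D // struct_cst_diag.
Qed.

Lemma koszul_skew i j k : koszul i j k = - koszul i k j.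
Proof.
rewrite /koszul (c_skew i k) (c_skew k j) (c_skew j i); lra.
Qed.

Lemma conn_mxE k l : conn_mx k l = (\sum_i M i i) / 2 * (k == l)%:R - M l k.
Proof.
rewrite /conn_mx /koszul sum3E.
by case: (ord3E k) => ->; case: (ord3E l) => ->; rewrite ?ord3D !struct_cst_cross
  ?eqxx ?ord3_eqE /=; lra.
Qed.

Definition jacobi_cst : Prop := forall k,
  \sum_l (c 1 2 l * c 0 l k + c 2 0 l * c 1 l k + c 0 1 l * c 2 l k) = 0.

(** By the first Bianchi identity: the difference of the two sides is one of the
three components of the Jacobi identity, up to sign. *)
Lemma koszul_ricci_sym : jacobi_cst ->
  forall k l, koszul_ricci k l = koszul_ricci l k.
Proof.
move=> J; have := (J 0, J 1, J 2); rewrite !sum3E !struct_cst_cross => -[[J0 J1] J2].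
have asym : [/\ koszul_ricci 0 1 = koszul_ricci 1 0,
  koszul_ricci 0 2 = koszul_ricci 2 0
  & koszul_ricci 1 2 = koszul_ricci 2 1].
  rewrite /koszul_ricci !sum3E /koszul !struct_cst_cross.
  split; lra.
case: asym => a01 a02 a12 k l.
by case: (ord3E k) => ->; case: (ord3E l) => ->.
Qed.

End StructureConstants.

Section AdjugateEquation.
Variables (R : realFieldType) (p q r u v w m : R).
Hypotheses (m0 : m != 0).
Hypotheses (Hp : p = m * (q * r - w ^+ 2)) (Hq : q = m * (p * r - v ^+ 2))
  (Hr : r = m * (p * q - u ^+ 2)) (Hu : u = m * (v * w - u * r))
  (Hv : v = m * (u * w - v * q)) (Hw : w = m * (u * v - w * p)).

(** The hypotheses say that the symmetric matrix W with diagonal (p, q, r) and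
off-diagonal entries u = W_01, v = W_02, w = W_12 satisfies W = m adj W.
Multiplying by W gives W^2 = m det(W) I, hence the vanishing of the off-diagonal
entries of W^2 and the equality of its diagonal ones.  Substituted back into the
hypotheses, these give u (1 + m tr W) = 0 and the same for v, w, p - q and q - r.
The second case describes tr(W) I - W as a matrix of rank one, by its minors. *)
Lemma adjugate_equation :
  [/\ u = 0, v = 0, w = 0, p = q & q = r] \/
  [/\ p + q + r != 0,
      [/\ (q + r) * (p + r) = u ^+ 2, (q + r) * (p + q) = v ^+ 2
        & (p + r) * (p + q) = w ^+ 2] &
      [/\ - (q + r) * w = u * v, - (p + r) * v = u * w
        & - (p + q) * u = v * w]].
Proof.
(* The entries of W * W, computed as those of W * (m adj W). *)
have times (x y z : R) : y = z -> x * y = x * z by move=> ->.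
have sq01 : p * u + u * q + v * w = 0.
  have := (times p _ _ Hu, times u _ _ Hq, times v _ _ Hw) => -[[h1 h2] h3]; lra.
have sq02 : p * v + u * w + v * r = 0.
  have := (times p _ _ Hv, times u _ _ Hw, times v _ _ Hr) => -[[h1 h2] h3]; lra.
have sq12 : u * v + q * w + w * r = 0.
  have := (times u _ _ Hv, times q _ _ Hw, times w _ _ Hr) => -[[h1 h2] h3]; lra.
have sq_diag : p ^+ 2 + u ^+ 2 + v ^+ 2 = u ^+ 2 + q ^+ 2 + w ^+ 2 /\
    u ^+ 2 + q ^+ 2 + w ^+ 2 = v ^+ 2 + w ^+ 2 + r ^+ 2.
  have := (times p _ _ Hp, times u _ _ Hu, times v _ _ Hv, times q _ _ Hq,
    times w _ _ Hw, times r _ _ Hr) => -[[[[[h1 h2] h3] h4] h5] h6].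
  rewrite !expr2; split; lra.
have [s1 s2] := sq_diag.
have [tau|tau] := eqVneq (1 + m * (p + q + r)) 0; [right|left].
  have mI : m^-1 = - (p + q + r).
    apply: (mulfI m0); rewrite mulfV //; lra.
  have inv (x y : R) : x = m * y -> y = - (p + q + r) * x.
    by move=> ->; rewrite mulrA -mI mulVf // mul1r.
  have := (inv _ _ Hp, inv _ _ Hq, inv _ _ Hr) => -[[ip iq] ir].
  split.
  - by apply/eqP => t0; move: tau; rewrite t0 mulr0 addr0 => /eqP; rewrite oner_eq0.
  - split; lra.
  - split; lra.
have cancel (x : R) : x * (1 + m * (p + q + r)) = 0 -> x = 0.
  by move/eqP; rewrite mulf_eq0 (negbTE tau) orbF => /eqP.
have zero (x y z : R) : x = y -> z = 0 -> x - y + m * z = 0.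
  by move=> -> ->; rewrite subrr mulr0 addr0.
have uncancel (x y z : R) : x = y -> z = 0 ->
    x * (1 + m * (p + q + r)) = x - y + m * z -> x = 0.
  by move=> xy z0 E; apply: cancel; rewrite E zero.
have d1 : (p ^+ 2 + u ^+ 2 + v ^+ 2) - (u ^+ 2 + q ^+ 2 + w ^+ 2) = 0.
  by rewrite s1 subrr.
have d2 : (u ^+ 2 + q ^+ 2 + w ^+ 2) - (v ^+ 2 + w ^+ 2 + r ^+ 2) = 0.
  by rewrite s2 subrr.
have Hpq : p - q = m * (q * r - w ^+ 2) - m * (p * r - v ^+ 2) by rewrite -Hp -Hq.
have Hqr : q - r = m * (p * r - v ^+ 2) - m * (p * q - u ^+ 2) by rewrite -Hq -Hr.
split.
- by apply: (uncancel _ _ _ Hu sq01); ring.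
- by apply: (uncancel _ _ _ Hv sq02); ring.
- by apply: (uncancel _ _ _ Hw sq12); ring.
- by apply/eqP; rewrite -subr_eq0; apply/eqP; apply: (uncancel _ _ _ Hpq d1); ring.
- by apply/eqP; rewrite -subr_eq0; apply/eqP; apply: (uncancel _ _ _ Hqr d2); ring.
Qed.

End AdjugateEquation.

Section RicciKillingClassification.
Variables (R : realFieldType) (c : 'I_3 -> 'I_3 -> 'I_3 -> R).
Hypothesis c_skew : forall i j k, c i j k = - c j i k.
Local Notation M := (cross_mx c).

(** Since Ric is symmetric, so are W and M, and Ric = 2 adj W.  The two cases of
[adjugate_equation] are M scalar and M = tr(W) I - W of rank one; in the second
one z is a row of M whose diagonal entry is nonzero. *)
Lemma ricci_killing_classification (mu : R) : jacobi_cst c -> mu != 0 ->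
  (forall k l, conn_mx c k l = 2 * mu * koszul_ricci c k l) ->
  [\/ forall l k, M l k = 0,
      exists2 a : R, a != 0 & forall l k, M l k = a * (l == k)%:R |
      exists (t : R) (z : 'I_3 -> R), [/\ t != 0, exists i : 'I_3, z i != 0 &
        forall l k, M l k = t * z l * z k]].
Proof.
move=> J mu0 rk.
have ric_sym := koszul_ricci_sym c_skew J.
have Msym l k : M l k = M k l.
  have := rk k l; rewrite (ric_sym k l) -(rk l k) !(conn_mxE c_skew).
  by rewrite [k == l]eq_sym => /addrI /oppr_inj.
have ME k l : M l k = (M 0 0 + M 1 1 + M 2 2) / 2 * (k == l)%:R - conn_mx c k l.
  by rewrite (conn_mxE c_skew) sum3E; ring.
set tr := M 0 0 + M 1 1 + M 2 2 in ME.
have [[M10 M20] M21] := (Msym 1 0, Msym 2 0, Msym 2 1).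
have ricE (W := conn_mx c) (Ric := koszul_ricci c) :
  [/\ [/\ Ric 0 0 = 2 * (W 1 1 * W 2 2 - W 1 2 ^+ 2),
          Ric 1 1 = 2 * (W 0 0 * W 2 2 - W 0 2 ^+ 2) &
          Ric 2 2 = 2 * (W 0 0 * W 1 1 - W 0 1 ^+ 2)],
      Ric 0 1 = 2 * (W 0 2 * W 1 2 - W 0 1 * W 2 2),
      Ric 0 2 = 2 * (W 0 1 * W 1 2 - W 0 2 * W 1 1) &
      Ric 1 2 = 2 * (W 0 1 * W 0 2 - W 1 2 * W 0 0)].
  rewrite /W /Ric {W Ric}.
  rewrite !(conn_mxE c_skew) !sum3E.
  rewrite /koszul_ricci !sum3E /koszul !(struct_cst_cross c_skew) M10 M20 M21.
  rewrite ?eqxx ?ord3_eqE /=.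
  by split; [split|..]; field.
case: ricE => -[R0 R1 R2] R01 R02 R12.
have m0 : 4 * mu != 0 by rewrite mulf_neq0 // pnatr_eq0.
have E (x y z : R) : x = 2 * mu * y -> y = 2 * z -> x = 4 * mu * z.
  by move=> -> ->; ring.
have := adjugate_equation m0 (E _ _ _ (rk 0 0) R0) (E _ _ _ (rk 1 1) R1)
  (E _ _ _ (rk 2 2) R2) (E _ _ _ (rk 0 1) R01) (E _ _ _ (rk 0 2) R02)
  (E _ _ _ (rk 1 2) R12).
rewrite !(conn_mxE c_skew) !sum3E ?eqxx ?ord3_eqE /= M10 M20 M21.
case=> [[u0 v0 w0 pq qr]|[tr0 [m1 m2 m3] [m4 m5 m6]]].
  have D01 : M 0 1 = 0 by lra.
  have D02 : M 0 2 = 0 by lra.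
  have D12 : M 1 2 = 0 by lra.
  have D1 : M 1 1 = M 0 0 by lra.
  have D2 : M 2 2 = M 0 0 by lra.
  have MD l k : M l k = M 0 0 * (l == k)%:R.
    by case: (ord3E l) => ->; case: (ord3E k) => ->;
      rewrite ?M10 ?M20 ?M21 ?D01 ?D02 ?D12 ?D1 ?D2 ?eqxx ?ord3_eqE ?mulr1 ?mulr0.
  have [z|nz] := eqVneq (M 0 0) 0; last by constructor 2; exists (M 0 0).
  by constructor 1 => l k; rewrite MD z mul0r.
constructor 3.
have minors i l k : M i i * M l k = M i l * M i k.
  clear -m1 m2 m3 m4 m5 m6 M10 M20 M21.
  by case: (ord3E i) => ->; case: (ord3E l) => ->; case: (ord3E k) => ->;
    rewrite ?M10 ?M20 ?M21; lra.
have [i Mii] : exists i, M i i != 0.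
  have [z0|] := eqVneq (M 0 0) 0; last by exists 0.
  have [z1|] := eqVneq (M 1 1) 0; last by exists 1.
  have [z2|] := eqVneq (M 2 2) 0; last by exists 2.
  by move/eqP: tr0; case; rewrite z0 z1 z2; lra.
exists (M i i)^-1, (M i); split; [by rewrite invr_eq0|by exists i|].
by move=> l k; rewrite -mulrA -minors mulKf.
Qed.

Lemma conn_mx_scalar (a : R) : (forall l k, M l k = a * (l == k)%:R) ->
  forall k l, conn_mx c k l = a / 2 * (k == l)%:R.
Proof.
by move=> ME k l; rewrite (conn_mxE c_skew) sum3E !ME !eqxx [k == l]eq_sym /=; field.
Qed.

Lemma koszul_ricci_scalar (a : R) : (forall l k, M l k = a * (l == k)%:R) ->
  forall k l, koszul_ricci c k l = a ^+ 2 / 2 * (k == l)%:R.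
Proof.
move=> ME k l; rewrite /koszul_ricci !sum3E /koszul.
by case: (ord3E k) => ->; case: (ord3E l) => ->;
  rewrite !(struct_cst_cross c_skew) !ME ?eqxx ?ord3_eqE /=; by field.
Qed.

(** W has the eigenvalues w, w, -w with w = t |z|^2 / 2, so that
Ric = 2 adj W = - 2 w W. *)
Lemma koszul_ricci_rank1 (t : R) z : (forall l k, M l k = t * z l * z k) ->
  forall k l, koszul_ricci c k l = - (t * \sum_i z i ^+ 2) * conn_mx c k l.
Proof.
move=> ME k l; rewrite (conn_mxE c_skew) /koszul_ricci !sum3E /koszul.
by case: (ord3E k) => ->; case: (ord3E l) => ->;
  rewrite !(struct_cst_cross c_skew) !ME ?eqxx ?ord3_eqE /=; by field.
Qed.

(** W is a multiple of the identity only if z z^T is, and the latter has rank one. *)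
Lemma conn_mx_rank1_nscalar (t : R) z i b : (forall l k, M l k = t * z l * z k) ->
  t != 0 -> z i != 0 ->
  ~ (forall k l, conn_mx c k l = b * (k == l)%:R).
Proof.
move=> ME t0 zi rot.
have ME' l k :
    (M 0 0 + M 1 1 + M 2 2) / 2 * (k == l)%:R - t * z l * z k = b * (k == l)%:R.
  by rewrite -rot (conn_mxE c_skew) sum3E (ME l k).
have ii : i + 1 != i.
  by case: (ord3E i) => ->; rewrite ?ord3D.
have off l k : k != l -> z l * z k = 0.
  move=> kl; have := ME' l k; rewrite (negbTE kl) !mulr0 sub0r -mulrA => /eqP.
  by rewrite oppr_eq0 mulf_eq0 (negbTE t0) => /eqP.
have dia l k : z l ^+ 2 = z k ^+ 2.
  have := ME' l l; have := ME' k k; rewrite !eqxx => e1 e2.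
  apply: (mulfI t0); rewrite !expr2; lra.
have : z i ^+ 2 * z i ^+ 2 = 0.
  by rewrite {2}(dia i (i + 1)) -exprMn off ?expr0n // ii.
by move/eqP; rewrite mulf_eq0 orbb sqrf_eq0 (negbTE zi).
Qed.

End RicciKillingClassification.

(** * Left-invariant orthonormal frames *)

Section Frame.
Variables (R : realType) (G : lieGroup3 R) (g : metric G).
Variable e : 'I_3 -> field G.
Hypotheses (g_riemannian : riemannian g)
  (g_left_invariant : left_invariant_metric g).
Hypothesis e_frame : left_invariant_onframe g e.
Implicit Types (X Y Z : field G) (f h : G -> R).

Lemma fieldDE X Y x f : (X + Y) x f = X x f + Y x f. Proof. by []. Qed.

Lemma fieldNE X x f : (- X) x f = - X x f. Proof. by []. Qed.

Lemma fscaleE h X x f : fscale h X x f = h x * X x f. Proof. by []. Qed.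

Lemma cscaleE a X x f : cscale a X x f = a * X x f. Proof. by []. Qed.

Lemma metricC (x : G) u v : tangent x u -> tangent x v -> g x u v = g x v u.
Proof. by case: g_riemannian => _ + _ _; apply. Qed.

Lemma metric_lincomb (x : G) u v w a : tangent x u -> tangent x v -> tangent x w ->
  g x (fun f => a * u f + v f) w = a * g x u w + g x v w.
Proof. by case: g_riemannian => + _ _ _; apply. Qed.

Lemma metric0 (x : G) w : tangent x w -> g x (fun=> 0) w = 0.
Proof.
move=> tw; have := metric_lincomb 1 (tangent0 x) (tangent0 x) tw.
by rewrite mul1r addr0; lra.
Qed.

Lemma frame_vfield i : vfield (e i).
Proof. by case: e_frame => /(_ i)[]. Qed.

Lemma frame_tangent i x : tangent x (e i x).
Proof. exact: vfield_tangent (frame_vfield i). Qed.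

Lemma frame_orthonormal i j x : g x (e i x) (e j x) = (i == j)%:R.
Proof. by case: e_frame. Qed.

Lemma gfun_lincomb h X Y Z x : vfield X -> vfield Y -> vfield Z ->
  gfun g (fscale h X + Y) Z x = h x * gfun g X Z x + gfun g Y Z x.
Proof.
by move=> vX vY vZ; apply: metric_lincomb; exact: vfield_tangent.
Qed.

Lemma gfunC X Y x : vfield X -> vfield Y -> gfun g X Y x = gfun g Y X x.
Proof. by move=> vX vY; apply: metricC; exact: vfield_tangent. Qed.

Lemma gfunD X Y Z x : vfield X -> vfield Y -> vfield Z ->
  gfun g (X + Y) Z x = gfun g X Z x + gfun g Y Z x.
Proof. by move=> vX vY vZ; rewrite -{1}(fscale1 X) gfun_lincomb // mul1r. Qed.

Lemma gfun0 Z x : vfield Z -> gfun g 0 Z x = 0.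
Proof. by move=> vZ; apply: metric0; exact: vfield_tangent. Qed.

Lemma gfunZ h X Z x : vfield X -> vfield Z ->
  gfun g (fscale h X) Z x = h x * gfun g X Z x.
Proof.
move=> vX vZ; rewrite -[fscale h X]addr0 gfun_lincomb ?gfun0 ?addr0 //.
exact: vfield0.
Qed.

Lemma gfun_sum (F : 'I_3 -> field G) Z x : (forall i, vfield (F i)) -> vfield Z ->
  gfun g (\sum_i F i) Z x = \sum_i gfun g (F i) Z x.
Proof.
move=> vF vZ; rewrite !sum3E !gfunD //; exact: vfieldD.
Qed.

Lemma smooth_gfun X Y : vfield X -> vfield Y -> smooth (gfun g X Y).
Proof. by case: g_riemannian => _ _ _; apply. Qed.

Lemma frame_expansion X : vfield X ->
  X = \sum_i fscale (gfun g X (e i)) (e i).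
Proof.
move=> vX; apply/funext => x.
have [_ _ /(_ x _ (vfield_tangent x vX)) [c Xc]] := e_frame.
have cE k : gfun g X (e k) x = c k.
  rewrite /gfun Xc.
  have on i := frame_orthonormal i k x; have t i := frame_tangent i x.
  have -> : (fun f => \sum_i c i * e i x f) =
    (fun f => c 0 * e 0 x f + (c 1 * e 1 x f + (c 2 * e 2 x f + 0))).
    by apply/funext => f; rewrite sum3E addr0 addrA.
  have t0 := tangent0 x.
  have t2 := tangent_lincomb (t 2) (c 2) t0.
  have t1 := tangent_lincomb (t 1) (c 1) t2.
  rewrite !metric_lincomb // metric0 // !on.
  by case: (ord3E k) => -> /=; ring.
rewrite Xc sum3E; apply/funext => f.
by rewrite !fctE /fscale !cE sum3E.
Qed.

Lemma frame_ext X Y : vfield X -> vfield Y ->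
  (forall k x, gfun g X (e k) x = gfun g Y (e k) x) -> X = Y.
Proof.
move=> vX vY XY; rewrite (frame_expansion vX) (frame_expansion vY).
by apply: eq_bigr => i _; congr fscale; apply/funext => x.
Qed.

Definition frame_comb (a : 'I_3 -> R) : field G := \sum_i cscale (a i) (e i).

Lemma vfield_cscale a X : vfield X -> vfield (cscale a X).
Proof. by apply: vfield_fscale; exact: smooth_cst. Qed.

Lemma vfield_frame_comb a : vfield (frame_comb a).
Proof. by apply: vfield_sum => i; apply: vfield_cscale; exact: frame_vfield. Qed.

Lemma gfun_frame_comb a k x : gfun g (frame_comb a) (e k) x = a k.
Proof.
have v := frame_vfield; rewrite gfun_sum // => [|i]; last exact: vfield_cscale.
rewrite sum3E !gfunZ // /gfun !frame_orthonormal.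
by case: (ord3E k) => -> /=; ring.
Qed.

(** By left-invariance of the metric: this is why all coefficients in the frame
are constants. *)
Lemma lie_algebra_gfun X Y x : lie_algebra X -> lie_algebra Y ->
  gfun g X Y x = gfun g X Y 1%g.
Proof.
move=> [vX iX] [vY iY]; rewrite /gfun -[x]mulg1 iX iY.
by rewrite g_left_invariant //; exact: vfield_tangent.
Qed.

Lemma left_invariant_frame_comb a : left_invariant (frame_comb a).
Proof.
case: e_frame => le _ _; move=> y x; apply/funext => f.
rewrite /frame_comb /dL !sum3E !fctE /cscale /fscale.
by rewrite (le 0).2 (le 1).2 (le 2).2.
Qed.

(** In a left-invariant frame, left-invariance means constant coordinates. *)
Lemma lie_algebraP X : lie_algebra X <-> exists a, X = frame_comb a.
Proof.
split=> [lX|[a ->]]; last first.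
  by split; [exact: vfield_frame_comb|exact: left_invariant_frame_comb].
exists (fun k => gfun g X (e k) 1%g); apply: frame_ext.
- by case: lX.
- exact: vfield_frame_comb.
move=> k x; rewrite gfun_frame_comb; apply: lie_algebra_gfun => //.
by case: e_frame.
Qed.

Lemma lie_algebra_bracket X Y : lie_algebra X -> lie_algebra Y ->
  lie_algebra (bracket X Y).
Proof.
move=> [vX iX] [vY iY]; split; first exact: vfield_bracket.
move=> a x; apply/funext => f; rewrite /dL /bracket iX iY /dL.
congr (X x _ - Y x _); apply/funext => y.
  by rewrite /app iY.
by rewrite /app iX.
Qed.

Definition struct_cst (i j k : 'I_3) : R := gfun g (bracket (e i) (e j)) (e k) 1%g.

Lemma gfun_bracket_frame i j k x :
  gfun g (bracket (e i) (e j)) (e k) x = struct_cst i j k.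
Proof.
case: e_frame => le _ _; apply: lie_algebra_gfun => //.
exact: lie_algebra_bracket.
Qed.

Lemma bracket_frame i j : bracket (e i) (e j) = frame_comb (struct_cst i j).
Proof.
have vb := vfield_bracket (frame_vfield i) (frame_vfield j).
apply: frame_ext (vfield_frame_comb _) _ => // k x.
by rewrite gfun_bracket_frame gfun_frame_comb.
Qed.

Lemma struct_cst_skew i j k : struct_cst i j k = - struct_cst j i k.
Proof.
have v := frame_vfield.
rewrite -(gfun_bracket_frame i j k 1%g) bracket_skew bracket_frame.
have -> : - frame_comb (struct_cst j i) = frame_comb (fun k => - struct_cst j i k).
  apply/funext => x; apply/funext => f.
  by rewrite /frame_comb !sum3E !fctE /cscale /fscale; ring.
by rewrite gfun_frame_comb.
Qed.

Lemma bracket_cst_lincomb a X Y Z : vfield X -> vfield Y -> vfield Z ->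
  bracket (cscale a X + Y) Z = cscale a (bracket X Z) + bracket Y Z.
Proof.
move=> vX vY vZ; rewrite bracket_lincomb //; last exact: smooth_cst.
congr (_ + _); apply/funext => x; apply/funext => f.
by rewrite !fctE /fscale (tangent_cst (vfield_tangent x vZ)) oppr0 mul0r addr0.
Qed.

Lemma bracket_frame_combl a Z : vfield Z ->
  bracket (frame_comb a) Z = \sum_i cscale (a i) (bracket (e i) Z).
Proof.
move=> vZ; have v := frame_vfield; have v0 := vfield0 G.
have vc i : vfield (cscale (a i) (e i)) by exact: vfield_cscale.
have b0 : bracket 0 Z = 0.
  apply/funext => x; apply/funext => f.
  by rewrite /bracket /= (tangent_cst (vfield_tangent x vZ)) subr0.
rewrite /frame_comb !sum3E -!addrA -[cscale (a 2) (e 2)]addr0.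
rewrite !bracket_cst_lincomb ?b0 ?addr0 //; exact: vfieldD.
Qed.

Lemma bracket_frame_combr a Z : vfield Z ->
  bracket Z (frame_comb a) = \sum_i cscale (a i) (bracket Z (e i)).
Proof.
move=> vZ; rewrite bracket_skew bracket_frame_combl //.
apply/funext => x; apply/funext => f; rewrite !sum3E !fctE /cscale /fscale.
by rewrite /bracket; ring.
Qed.

Lemma bracket_frame_comb a b : bracket (frame_comb a) (frame_comb b) =
  frame_comb (fun k => \sum_i \sum_j a i * b j * struct_cst i j k).
Proof.
have vb := vfield_frame_comb b; have v := frame_vfield.
rewrite bracket_frame_combl //.
under eq_bigr do rewrite bracket_frame_combr //.
under eq_bigr do under eq_bigr do rewrite bracket_frame.
apply/funext => x; apply/funext => f.
by rewrite /frame_comb !sum3E !(fieldDE, cscaleE); ring.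
Qed.

Lemma struct_cst_jacobi k :
  \sum_l (struct_cst 1 2 l * struct_cst 0 l k + struct_cst 2 0 l * struct_cst 1 l k
    + struct_cst 0 1 l * struct_cst 2 l k) = 0.
Proof.
have v := frame_vfield; have := jacobi (v 0) (v 1) (v 2).
rewrite !bracket_frame !bracket_frame_combr //.
under eq_bigr do rewrite bracket_frame.
under [X in _ + X + _]eq_bigr do rewrite bracket_frame.
under [X in _ + _ + X]eq_bigr do rewrite bracket_frame.
move=> J.
have vs a i : vfield (\sum_j cscale (a j) (frame_comb (struct_cst i j))).
  by apply: vfield_sum => j; apply: vfield_cscale; exact: vfield_frame_comb.
have Es a i : gfun g (\sum_j cscale (a j) (frame_comb (struct_cst i j))) (e k) 1%g =
    \sum_j a j * struct_cst i j k.
  have vfc := vfield_frame_comb.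
  rewrite gfun_sum // => [|j]; last exact: vfield_cscale.
  by apply: eq_bigr => j _; rewrite gfunZ // gfun_frame_comb.
have := gfun0 1%g (v k); rewrite -{1}J !gfunD //; last exact: vfieldD.
by move=> J0; rewrite -[RHS]J0 !Es !sum3E; ring.
Qed.

End Frame.

(** * The Levi-Civita connection in a left-invariant frame *)

Section LeviCivita.
Variables (R : realType) (G : lieGroup3 R) (g : metric G).
Variables (nabla : field G -> field G -> field G) (e : 'I_3 -> field G).
Hypotheses (g_riemannian : riemannian g)
  (g_left_invariant : left_invariant_metric g).
Hypothesis nabla_levi_civita : levi_civita g nabla.
Hypothesis e_frame : left_invariant_onframe g e.
Implicit Types (X Y Z : field G) (f h : G -> R).

Local Notation c := (struct_cst g e).
Let ve := frame_vfield e_frame.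

(** Linearity over smooth functions, in the form in which it holds for a connection
in its first argument. *)
Definition tensorial (T : field G -> field G) : Prop :=
  (forall X, vfield X -> vfield (T X)) /\
  (forall h X Y, smooth h -> vfield X -> vfield Y ->
    T (fscale h X + Y) = fscale h (T X) + T Y).

Lemma tensorial0 T : tensorial T -> T 0 = 0.
Proof.
case=> vT linT; have := linT _ _ _ (smooth_cst 1) (vfield0 G) (vfield0 G).
by rewrite !fscale1 addr0 => T0; apply: (addrI (T 0)); rewrite addr0.
Qed.

Lemma gfun_tensorial T X Z x : tensorial T -> vfield X -> vfield Z ->
  gfun g (T X) Z x = \sum_k gfun g X (e k) x * gfun g (T (e k)) Z x.
Proof.
move=> tT vX vZ; have T0 := tensorial0 tT; case: tT => vT linT.
have v0 := vfield0 G.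
have sX k : smooth (gfun g X (e k)) by exact: smooth_gfun.
rewrite {1}(frame_expansion g_riemannian e_frame vX) sum3E -!addrA.
have v2 : vfield (fscale (gfun g X (e 2)) (e 2)) by exact: vfield_fscale.
have vTe k : vfield (fscale (gfun g X (e k)) (T (e k))).
  by apply: vfield_fscale => //; exact: vT.
rewrite -[fscale (gfun g X (e 2)) (e 2)]addr0.
rewrite !linT ?T0 //; try (by do ! apply: vfield_lincomb).
rewrite addr0 !(gfunD g_riemannian) //; last exact: vfieldD.
by rewrite !(gfunZ g_riemannian) ?sum3E ?addrA //; exact: vT.
Qed.

Lemma vfield_nabla X Y : vfield X -> vfield Y -> vfield (nabla X Y).
Proof. by case: nabla_levi_civita => -[+ _ _ _] _ _; apply. Qed.

Lemma tensorial_nabla Z : vfield Z -> tensorial (nabla^~ Z).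
Proof.
move=> vZ; split=> [X vX|h X Y sh vX vY]; first exact: vfield_nabla.
by case: nabla_levi_civita => -[_ + _ _] _ _; apply.
Qed.

Lemma nablaD X Y Z : vfield X -> vfield Y -> vfield Z ->
  nabla X (Y + Z) = nabla X Y + nabla X Z.
Proof. by case: nabla_levi_civita => -[_ _ + _] _ _; apply. Qed.

Lemma nabla_leibniz h X Y : smooth h -> vfield X -> vfield Y ->
  nabla X (fscale h Y) = fscale (app X h) Y + fscale h (nabla X Y).
Proof. by case: nabla_levi_civita => -[_ _ _ +] _ _; apply. Qed.

Lemma nabla_cscale a X Y : vfield X -> vfield Y ->
  nabla X (cscale a Y) = cscale a (nabla X Y).
Proof.
move=> vX vY; rewrite nabla_leibniz //; last exact: smooth_cst.
apply/funext => x; apply/funext => f; rewrite fieldDE /fscale /app.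
by rewrite (tangent_cst (vfield_tangent x vX)) mul0r add0r.
Qed.

(** The scalar products of the frame are constant, so metric compatibility says that
the coefficients are skew in their last two indices; together with the absence
of torsion this determines them. *)
Lemma gfun_nabla_frame i j k x :
  gfun g (nabla (e i) (e j)) (e k) x = koszul c i j k.
Proof.
have vn a b := vfield_nabla (ve a) (ve b).
case: nabla_levi_civita => _ torsion_free metric_compat.
have skew a b d : gfun g (nabla (e a) (e b)) (e d) x =
    - gfun g (nabla (e a) (e d)) (e b) x.
  have := metric_compat _ _ _ (ve a) (ve b) (ve d) x.
  have -> : gfun g (e b) (e d) = (fun=> (b == d)%:R).
    by apply/funext => y; rewrite /gfun (frame_orthonormal e_frame).
  rewrite (tangent_cst (frame_tangent e_frame a x)).
  rewrite (gfunC g_riemannian x (ve b)) // => /esym/eqP.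
  by rewrite addr_eq0 => /eqP.
have tors a b d : gfun g (nabla (e a) (e b)) (e d) x =
    c a b d + gfun g (nabla (e b) (e a)) (e d) x.
  rewrite -(gfun_bracket_frame g_left_invariant e_frame a b d x).
  rewrite -(gfunD g_riemannian) //; last exact: vfield_bracket.
  by rewrite -torsion_free // subrK.
rewrite /koszul.
have := (tors i j k, tors j k i, tors k i j, skew i j k, skew j k i, skew k i j).
move=> [[[[[t1 t2] t3] s1] s2] s3]; lra.
Qed.

Lemma nabla_frame i j : nabla (e i) (e j) = frame_comb e (koszul c i j).
Proof.
apply: (frame_ext g_riemannian e_frame); first exact: vfield_nabla.
  exact: (vfield_frame_comb e_frame).
by move=> k x; rewrite gfun_nabla_frame (gfun_frame_comb g_riemannian).
Qed.

Lemma gfun_nabla X i j x : vfield X ->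
  gfun g (nabla X (e i)) (e j) x = \sum_k gfun g X (e k) x * koszul c k i j.
Proof.
move=> vX; rewrite (gfun_tensorial x (tensorial_nabla (ve i)) vX) //.
by apply: eq_bigr => k _; rewrite gfun_nabla_frame.
Qed.

Lemma nabla_frame_combl a j :
  nabla (frame_comb e a) (e j) =
  frame_comb e (fun k => \sum_m a m * koszul c m j k).
Proof.
have va := vfield_frame_comb e_frame a.
apply: (frame_ext g_riemannian e_frame); first exact: vfield_nabla.
  exact: (vfield_frame_comb e_frame).
move=> k x; rewrite gfun_nabla // (gfun_frame_comb g_riemannian) //.
by apply: eq_bigr => m _; rewrite (gfun_frame_comb g_riemannian).
Qed.

Lemma nabla_frame_combr i a :
  nabla (e i) (frame_comb e a) =
  frame_comb e (fun k => \sum_m a m * koszul c i m k).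
Proof.
have vc k : vfield (cscale (a k) (e k)) by exact: vfield_cscale.
rewrite [in LHS]/frame_comb sum3E !nablaD //; last exact: vfieldD.
rewrite !nabla_cscale // !nabla_frame.
apply/funext => x; apply/funext => f.
by rewrite /frame_comb !sum3E !(fieldDE, cscaleE); ring.
Qed.

Lemma vfield_curvature X Y Z : vfield X -> vfield Y -> vfield Z ->
  vfield (curvature nabla X Y Z).
Proof.
move=> vX vY vZ; have vb := vfield_bracket vX vY.
have vN A : vfield A -> vfield (- A).
  move=> vA; rewrite (_ : - A = fscale (fun=> -1) A).
    by apply: vfield_fscale => //; exact: smooth_cst.
  by apply/funext => x; apply/funext => f; rewrite /fscale mulN1r.
by apply: vfieldD; [apply: vfieldD|]; try apply: vN; apply: vfield_nabla => //;
  apply: vfield_nabla.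
Qed.

(** The derivatives of h produced by nabla_Z nabla_(h X) W and by [h X, Z]
cancel each other. *)
Lemma tensorial_curvature Z W : vfield Z -> vfield W ->
  tensorial (fun X => curvature nabla X Z W).
Proof.
move=> vZ vW; split=> [X vX|h X Y sh vX vY]; first exact: vfield_curvature.
have vn := vfield_nabla.
have linN A := (tensorial_nabla A).2.
have sZ : smooth (fun x => - Z x h).
  have := smoothZ (-1) (vfield_smooth vZ sh).
  by congr smooth; apply/funext => x; rewrite mulN1r.
have vb A B := @vfield_bracket _ _ A B.
have vsX : vfield (fscale (fun x => - Z x h) X + bracket Y Z).
  by apply: vfield_lincomb => //; exact: vb.
rewrite /curvature bracket_lincomb // -(addrA (fscale h (bracket X Z))).
rewrite (linN _ (vn _ _ vZ vW)) // !(linN _ vW) //; try exact: vb.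
rewrite nablaD //; [|by apply: vfield_fscale => //; exact: vn|exact: vn].
rewrite nabla_leibniz //; last exact: vn.
apply/funext => x; apply/funext => f.
by rewrite !(fieldDE, fieldNE, fscaleE) /app; ring.
Qed.

Lemma tensorial_ricci : tensorial (ricci nabla e).
Proof.
split=> [X vX|h X Y sh vX vY].
  by apply: vfield_sum => i; exact: vfield_curvature.
rewrite /ricci; under eq_bigr do rewrite (tensorial_curvature _ _).2 //.
apply/funext => x; apply/funext => f.
by rewrite !sum3E !(fieldDE, fscaleE); ring.
Qed.

Lemma gfun_ricci_frame k j x :
  gfun g (ricci nabla e (e k)) (e j) x = koszul_ricci c k j.
Proof.
have vR i : vfield (curvature nabla (e k) (e i) (e i)) by exact: vfield_curvature.
rewrite /ricci (gfun_sum g_riemannian) //; apply: eq_bigr => i _.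
have -> : curvature nabla (e k) (e i) (e i) = frame_comb e (fun j =>
    \sum_m (koszul c i i m * koszul c k m j
     - koszul c k i m * koszul c i m j - c k i m * koszul c m i j)).
  rewrite /curvature (bracket_frame g_riemannian) // !nabla_frame.
  rewrite !nabla_frame_combr nabla_frame_combl.
  apply/funext => y; apply/funext => f.
  by rewrite /frame_comb !sum3E !(fieldDE, fieldNE, cscaleE); ring.
by rewrite (gfun_frame_comb g_riemannian).
Qed.

Lemma gfun_ricci X j x : vfield X ->
  gfun g (ricci nabla e X) (e j) x = \sum_k gfun g X (e k) x * koszul_ricci c k j.
Proof.
move=> vX; rewrite (gfun_tensorial x tensorial_ricci vX) //.
by apply: eq_bigr => k _; rewrite gfun_ricci_frame.
Qed.

End LeviCivita.

(** * Invariant spinors and Killing equations *)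

Section CliffordModule.
Variable R : realType.
Implicit Types (s : 'cV[R[i]]_2) (a b : 'I_3 -> R).

Lemma cliff_cross (l : 'I_3) : cliff R (l + 1) *m cliff R (l + 2) = cliff R l.
Proof.
have ii : ('i)%C * ('i)%C = -1 :> R[i] by rewrite -expr2 sqr_i.
apply/matrixP => i j; rewrite !mxE !big_ord_recl !big_ord0.
case: (ord3E l) => ->; rewrite ?ord3D /cliff /=;
  case: i => [[|[|//]] hi]; case: j => [[|[|//]] hj]; rewrite !mxE /=;
  by rewrite ?(mulr0, mul0r, mulr1, mul1r, addr0, add0r, mulrN, mulNr, ii,
    opprK, oppr0).
Qed.

Lemma cliff_cross_opp (l : 'I_3) : cliff R (l + 2) *m cliff R (l + 1) = - cliff R l.
Proof.
have := cliff_anticomm R (l + 1) (l + 2); rewrite cliff_cross.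
have -> : (l + 1 == l + 2) = false by case: (ord3E l) => ->; rewrite ?ord3D.
rewrite mul0r raddf0 => /eqP; rewrite addrC addr_eq0 => /eqP //.
Qed.

Lemma cliff_sq (l : 'I_3) : cliff R l *m cliff R l = (-1)%:M.
Proof.
have ii : ('i)%C * ('i)%C = -1 :> R[i] by rewrite -expr2 sqr_i.
apply/matrixP => i j; rewrite !mxE !big_ord_recl !big_ord0.
case: (ord3E l) => ->; rewrite /cliff /=;
  case: i => [[|[|//]] hi]; case: j => [[|[|//]] hj]; rewrite !mxE /=;
  by rewrite ?(mulr0, mul0r, mulr1, mul1r, addr0, add0r, mulrN, mulNr, ii,
    opprK, oppr0).
Qed.

Definition cliff_act a s : 'cV[R[i]]_2 := \sum_l (a l)%:C%C *: (cliff R l *m s).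

Lemma cliff_actB a b s :
  cliff_act (fun l => a l - b l) s = cliff_act a s - cliff_act b s.
Proof.
rewrite /cliff_act -sumrB; apply: eq_bigr => l _.
by rewrite rmorphB /= scalerBl.
Qed.

Lemma cliff_actZ (t : R) a s :
  cliff_act (fun l => t * a l) s = t%:C%C *: cliff_act a s.
Proof.
rewrite /cliff_act scaler_sumr; apply: eq_bigr => l _.
by rewrite rmorphM /= scalerA.
Qed.

(** Because a . a . s = - |a|^2 s, a nonzero vector acts injectively on spinors. *)
Lemma cliff_act_eq0 a s : s != 0 -> cliff_act a s = 0 -> forall l, a l = 0.
Proof.
move=> s0 as0.
have sq : cliff_act a (cliff_act a s) = (- \sum_l a l ^+ 2)%:C%C *: s.
  have [[c0 c1] c2] := (cliff_cross 0, cliff_cross 1, cliff_cross 2).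
  have [[d0 d1] d2] := (cliff_cross_opp 0, cliff_cross_opp 1, cliff_cross_opp 2).
  rewrite !ord3D in c0 c1 c2 d0 d1 d2.
  rewrite /cliff_act !sum3E !mulmxDr -!scalemxAr !mulmxA.
  rewrite !cliff_sq c0 c1 c2 d0 d1 d2 !mul_scalar_mx !mulNmx.
  rewrite !rmorphN !rmorphD !rmorphXn /=.
  move: (a 0)%:C%C (a 1)%:C%C (a 2)%:C%C => x y z.
  move: (cliff R 0 *m s) (cliff R 1 *m s) (cliff R 2 *m s) => u v w.
  by apply/matrixP => i j; rewrite !mxE; move: (u i j) (v i j) (w i j) => *; ring.
move: sq; rewrite as0 {1}/cliff_act big1 => [|l _]; last by rewrite mulmx0 scaler0.
move/esym/eqP; rewrite scaler_eq0 (negbTE s0) orbF => /eqP [] /eqP.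
rewrite oppr_eq0 psumr_eq0 => [/allP h l|l _]; last exact: sqr_ge0.
by have := h l (mem_index_enum l); rewrite sqrf_eq0 => /eqP.
Qed.

(** A skew form on R^3 is a vector; as e_(l+1) . e_(l+2) = e_l, the Clifford action
of the form is twice that of the vector, each l arising from two ordered
pairs of indices. *)
Lemma cliff_skew (b : 'I_3 -> 'I_3 -> R) s : (forall i j, b i j = - b j i) ->
  \sum_i \sum_j (b i j)%:C%C *: (cliff R i *m (cliff R j *m s)) =
  2 *: cliff_act (fun l => b (l + 1) (l + 2)) s.
Proof.
move=> skew.
have d i : b i i = 0 by have := skew i i; lra.
have [[c0 c1] c2] := (cliff_cross 0, cliff_cross 1, cliff_cross 2).
have [[d0 d1] d2] := (cliff_cross_opp 0, cliff_cross_opp 1, cliff_cross_opp 2).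
rewrite !ord3D in c0 c1 c2 d0 d1 d2.
rewrite /cliff_act !sum3E !mulmxA c0 c1 c2 d0 d1 d2 !d !ord3D !mulNmx.
rewrite (skew 1 0) (skew 2 1) (skew 0 2) !rmorphN !rmorph0 /=.
move: (b 0 1)%:C%C (b 1 2)%:C%C (b 2 0)%:C%C => x y z.
move: (cliff R 0 *m s) (cliff R 1 *m s) (cliff R 2 *m s) => u v w.
by apply/matrixP => i j; rewrite !mxE; move: (u i j) (v i j) (w i j) => *; ring.
Qed.

End CliffordModule.

Section InvariantSpinors.
Variables (R : realType) (G : lieGroup3 R) (g : metric G).
Variables (nabla : field G -> field G -> field G) (e : 'I_3 -> field G).
Hypotheses (g_riemannian : riemannian g)
  (g_left_invariant : left_invariant_metric g).
Hypothesis nabla_levi_civita : levi_civita g nabla.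
Hypothesis e_frame : left_invariant_onframe g e.
Implicit Types (X Y Z : field G) (f h : G -> R).

Local Notation c := (struct_cst g e).
Let c_skew := struct_cst_skew g_riemannian g_left_invariant e_frame.

Lemma spinor_field_cst (s : 'cV[R[i]]_2) : spinor_field (fun _ : G => s).
Proof. by move=> k; split; exact: smooth_cst. Qed.

Lemma spin_nabla_cst (s : 'cV[R[i]]_2) X x : vfield X ->
  spin_nabla g nabla e X (fun=> s) x =
  cliff_act (fun l => 2^-1 * \sum_k gfun g X (e k) x * conn_mx c k l) s.
Proof.
move=> vX; rewrite /spin_nabla.
have -> : deriv_spinor X (fun=> s) x = 0.
  apply/matrixP => k j; rewrite !mxE !(tangent_cst (vfield_tangent x vX)).
  by [].
rewrite add0r; under eq_bigr do under eq_bigr do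
  rewrite (gfun_nabla g_riemannian g_left_invariant nabla_levi_civita e_frame) //.
rewrite cliff_skew => [|i j]; last first.
  rewrite -sumrN; apply: eq_bigr => k _.
  by rewrite (koszul_skew c_skew k i j) mulrN.
rewrite scalerA cliff_actZ; congr (_ *: _).
by rewrite fmorphV rmorph_nat; field.
Qed.

(** Both sides are Clifford actions on the same nonzero spinor, so the vectors acting
agree.  The Ricci Killing equation is the case T = Ric, the Killing equation
the case T = id. *)
Lemma killing_equation (T : field G -> field G) (K : 'I_3 -> 'I_3 -> R) (nu : R) s :
  s != 0 ->
  (forall X j x, vfield X ->
    gfun g (T X) (e j) x = \sum_k gfun g X (e k) x * K k j) ->
  (forall X, vfield X -> forall x, spin_nabla g nabla e X (fun=> s) x =
     nu%:C%C *: clifford_mul g e (T X) (fun=> s) x) <->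
  (forall k l, conn_mx c k l = 2 * nu * K k l).
Proof.
move=> s0 TK.
have cliffT X x : vfield X -> nu%:C%C *: clifford_mul g e (T X) (fun=> s) x =
    cliff_act (fun l => nu * \sum_k gfun g X (e k) x * K k l) s.
  move=> vX; rewrite cliff_actZ; congr (_ *: _).
  by apply: eq_bigr => j _; rewrite TK.
split=> [kE k l|rotK X vX x]; last first.
  rewrite spin_nabla_cst // cliffT //; congr cliff_act; apply/funext => l.
  by rewrite !mulr_sumr; apply: eq_bigr => k _; rewrite rotK; field.
have vk := frame_vfield e_frame k.
have := kE _ vk 1%g; rewrite spin_nabla_cst // cliffT // => /eqP.
rewrite -subr_eq0 -cliff_actB => /eqP /(cliff_act_eq0 s0) /(_ l).
have coord (F : 'I_3 -> R) : \sum_i gfun g (e k) (e i) 1%g * F i = F k.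
  rewrite (bigD1 k) //= /gfun (frame_orthonormal e_frame) eqxx mul1r.
  rewrite big1 ?addr0 // => i ik.
  by rewrite (frame_orthonormal e_frame) eq_sym (negbTE ik) mul0r.
by rewrite !coord; lra.
Qed.

Lemma ricci_killing_cst (mu : R) s : s != 0 ->
  ricci_killing_with g nabla e mu (fun=> s) <->
  mu != 0 /\ forall k l, conn_mx c k l = 2 * mu * koszul_ricci c k l.
Proof.
move=> s0; have E := @killing_equation (ricci nabla e) (koszul_ricci c) mu s s0
  (fun X j x => gfun_ricci g_riemannian g_left_invariant nabla_levi_civita
    e_frame j x).
split=> [[_ _ mu0 /E]|[mu0 /E]] //.
by split=> //; [exact: spinor_field_cst|exists 1%g].
Qed.

Lemma killing_cst (kappa : R) s : s != 0 ->
  killing_with g nabla e kappa (fun=> s) <->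
  forall k l, conn_mx c k l = 2 * kappa * (k == l)%:R.
Proof.
move=> s0.
have idK X j x : vfield X ->
    gfun g X (e j) x = \sum_k gfun g X (e k) x * (k == j)%:R.
  move=> vX; rewrite (bigD1 j) //= eqxx mulr1 big1 ?addr0 // => k kj.
  by rewrite (negbTE kj) mulr0.
have E := @killing_equation id (fun k l => (k == l)%:R) kappa s s0 idK.
split=> [[_ _ /E]|/E] //.
by split=> //; [exact: spinor_field_cst|exists 1%g].
Qed.

Lemma parallel_cst s : (forall k l, conn_mx c k l = 0) ->
  parallel g nabla e (fun=> s).
Proof.
move=> rot0; split=> [|X vX x]; first exact: spinor_field_cst.
rewrite spin_nabla_cst // /cliff_act big1 // => l _.
by rewrite big1 ?mulr0 ?scale0r // => k _; rewrite rot0 mulr0.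
Qed.

End InvariantSpinors.

(** * Recognizing the Lie algebra *)

Section LieAlgebra.
Variables (R : realType) (G : lieGroup3 R) (g : metric G).
Variable e : 'I_3 -> field G.
Hypotheses (g_riemannian : riemannian g)
  (g_left_invariant : left_invariant_metric g).
Hypothesis e_frame : left_invariant_onframe g e.
Implicit Types (X Y Z : field G) (a b : 'I_3 -> R).

Local Notation c := (struct_cst g e).
Local Notation M := (cross_mx c).
Local Notation fc := (frame_comb e).
Let c_skew := struct_cst_skew g_riemannian g_left_invariant e_frame.

Definition cross a b (l : 'I_3) : R := a (l + 1) * b (l + 2) - a (l + 2) * b (l + 1).

Lemma bracket_cross a b :
  bracket (fc a) (fc b) = fc (fun k => \sum_l cross a b l * M l k).
Proof.
rewrite (bracket_frame_comb g_riemannian) //; congr (fc _); apply/funext => k.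
by rewrite !sum3E !(struct_cst_cross c_skew) /cross !ord3D; ring.
Qed.

Lemma frame_combD a b : fc a + fc b = fc (fun k => a k + b k).
Proof.
apply/funext => x; apply/funext => f.
by rewrite /frame_comb !sum3E !(fieldDE, cscaleE); ring.
Qed.

Lemma frame_combZ t a : cscale t (fc a) = fc (fun k => t * a k).
Proof.
apply/funext => x; apply/funext => f.
by rewrite cscaleE /frame_comb !sum3E !(fieldDE, cscaleE); ring.
Qed.

Lemma frame_comb_inj a b : fc a = fc b -> forall k, a k = b k.
Proof.
move=> ab k; rewrite -(gfun_frame_comb g_riemannian e_frame a k 1%g) ab.
exact: (gfun_frame_comb g_riemannian e_frame).
Qed.

Lemma frame_comb0 : fc (fun=> 0) = 0.
Proof.
apply/funext => x; apply/funext => f.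
by rewrite /frame_comb sum3E !(fieldDE, cscaleE) !mul0r !addr0.
Qed.

Lemma frame_comb_delta i : fc (fun k => (k == i)%:R) = e i.
Proof.
apply/funext => x; apply/funext => f.
rewrite /frame_comb sum3E !(fieldDE, cscaleE).
by case: (ord3E i) => ->; rewrite ?eqxx ?ord3_eqE /=; ring.
Qed.

(** Left-invariant fields are their coordinate vectors, so an isomorphism may be given
on coordinates. *)
Lemma lie_isomorphic_coords (W : zmodType) (sc : R -> W -> W) (br : W -> W -> W)
    (B : set W) (Phi : ('I_3 -> R) -> W) :
  (forall a, B (Phi a)) -> (forall a b, Phi a = Phi b -> a = b) ->
  (forall w, B w -> exists a, Phi a = w) ->
  (forall a b, Phi (fun k => a k + b k) = Phi a + Phi b) ->
  (forall t a, Phi (fun k => t * a k) = sc t (Phi a)) ->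
  (forall a b, Phi (fun k => \sum_l cross a b l * M l k) = br (Phi a) (Phi b)) ->
  lie_isomorphic (@Defs.cscale R G) (@bracket R G) (@lie_algebra R G) sc br B.
Proof.
move=> PhiB Phi_inj Phi_surj PhiD PhiZ Phi_br.
pose co X k := gfun g X (e k) 1%g.
have coE a : co (fc a) = a.
  by apply/funext => k; exact: (gfun_frame_comb g_riemannian e_frame).
have laP := lie_algebraP g_riemannian g_left_invariant e_frame.
exists (Phi \o co); split => /=.
- split=> [X _|X Y|w /Phi_surj[a <-]].
  + exact: PhiB.
  + rewrite !inE => /laP[a ->] /laP[b ->] /=.
    by rewrite !coE => /Phi_inj ->.
  + by exists (fc a); [apply/laP; exists a|rewrite /= coE].
- by move=> X Y /laP[a ->] /laP[b ->]; rewrite frame_combD !coE.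
- by move=> t X /laP[a ->]; rewrite frame_combZ !coE.
- by move=> X Y /laP[a ->] /laP[b ->]; rewrite bracket_cross !coE.
Qed.

Lemma bracket_eq0 a b : (forall l k, M l k = 0) -> bracket (fc a) (fc b) = 0.
Proof.
move=> M0; rewrite bracket_cross -frame_comb0; congr (fc _); apply/funext => k.
by rewrite big1 // => l _; rewrite M0 mulr0.
Qed.

Lemma commutative_algebraP : commutative_algebra G <-> forall l k, M l k = 0.
Proof.
have laP := lie_algebraP g_riemannian g_left_invariant e_frame.
have [le _ _] := e_frame.
split=> [comm l k|M0 X Y /laP[a ->] /laP[b ->]]; last exact: bracket_eq0.
have := comm _ _ (le (l + 1)) (le (l + 2)).
by rewrite (bracket_frame g_riemannian) // -frame_comb0 => /frame_comb_inj; apply.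
Qed.

(** Clifford multiplication by the frame gives a basis of su(2) with commutators
[e_(l+1), e_(l+2)] = 2 e_l, hence the factor t / 2. *)
Lemma iso_su2_of_scalar t :
  t != 0 -> (forall l k, M l k = t * (l == k)%:R) -> iso_su2 G.
Proof.
move=> t0 ME.
pose Phi a : 'M[R[i]]_2 := (t / 2)%:C%C *:
  mx22 (Complex 0 (a 0)) (Complex (a 1) (a 2))
  (Complex (- a 1) (a 2)) (Complex 0 (- a 0)).
have PhiE a : Phi a =
  mx22 (Complex 0 (t / 2 * a 0)) (Complex (t / 2 * a 1) (t / 2 * a 2))
  (Complex (- (t / 2 * a 1)) (t / 2 * a 2)) (Complex 0 (- (t / 2 * a 0))).
  apply/matrixP => i j; rewrite !mxE.
  by case: i => [[|[|//]] hi]; case: j => [[|[|//]] hj] /=; congr Complex; ring.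
have t2 : t / 2 != 0 by rewrite mulf_neq0 // invr_eq0 pnatr_eq0.
apply: (lie_isomorphic_coords (Phi := Phi)).
- move=> a; rewrite PhiE; split.
    apply/matrixP => i j; rewrite !mxE.
    by case: i => [[|[|//]] hi]; case: j => [[|[|//]] hj] /=; congr Complex; ring.
  by rewrite /mxtrace !big_ord_recl big_ord0 !mxE /=; congr Complex; ring.
- move=> a b; rewrite !PhiE => /matrixP E.
  have := E 0 0; rewrite !mxE /= => -[/(mulfI t2) E0].
  have := E 0 1; rewrite !mxE /= => -[/(mulfI t2) E1 /(mulfI t2) E2].
  by apply/funext => k; case: (ord3E k) => ->.
- move=> w [/matrixP skew tr].
  pose a (k : 'I_3) := (t / 2)^-1 * (if k == 0 then complex.Im (w 0 0)
    else if k == 1 then complex.Re (w 0 1) else complex.Im (w 0 1)).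
  exists a; rewrite PhiE /a /= !(mulVKf t2) //.
  have s00 := skew 0 0; have s01 := skew 0 1; move: tr s00 s01.
  rewrite /mxtrace !big_ord_recl big_ord0.
  rewrite (_ : lift ord0 ord0 = 1); last exact/val_inj.
  rewrite !mxE /= addr0.
  have -> : w = mx22 (w 0 0) (w 0 1) (w 1 0) (w 1 1).
    apply/matrixP => i j; rewrite !mxE.
    by case: i => [[|[|//]] hi]; case: j => [[|[|//]] hj] /=; congr (w _ _);
      apply/val_inj.
  case: (w 0 0) (w 0 1) (w 1 0) (w 1 1) => [x00 y00] [x01 y01] [x10 y10] [x11 y11].
  have inj (u v : R[i]) : u = v ->
      complex.Re u = complex.Re v /\ complex.Im u = complex.Im v.
    by move=> ->.
  rewrite !mxE /= => /inj[/= d1 d2] /inj[/= d3 _] /inj[/= d4 d5].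
  by congr mx22; congr Complex; lra.
- move=> a b; rewrite /Phi -scalerDr; congr (_ *: _).
  apply/matrixP => i j; rewrite !mxE.
  by case: i => [[|[|//]] hi]; case: j => [[|[|//]] hj] /=; congr Complex; ring.
- move=> u a; rewrite !PhiE; apply/matrixP => i j; rewrite !mxE.
  by case: i => [[|[|//]] hi]; case: j => [[|[|//]] hj] /=; congr Complex; ring.
- move=> a b; rewrite !PhiE !sum3E !ME !eqxx !ord3_eqE /cross !ord3D.
  apply/matrixP => i j; rewrite /mxcomm !mxE !big_ord_recl !big_ord0 !mxE /=.
  by case: i => [[|[|//]] hi]; case: j => [[|[|//]] hj] /=; congr Complex; field.
Qed.


(** The coordinates x, y, w are those on E_01, E_12 and the centre E_02. *)
Definition heis_mx (x y w : R) : 'M[R]_3 := \matrix_(i, j)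
  if (i == 0) && (j == 1) then x else if (i == 1) && (j == 2) then y
  else if (i == 0) && (j == 2) then w else 0.

Lemma heis3P (N : 'M[R]_3) : @heis3 R N <-> exists x y w, N = heis_mx x y w.
Proof.
split=> [hN|[x [y [w ->]]] i j].
  exists (N 0 1), (N 1 2), (N 0 2); apply/matrixP => i j; rewrite !mxE.
  by case: (ord3E i) => ->; case: (ord3E j) => -> //=; exact: hN.
by rewrite !mxE; case: (ord3E i) => ->; case: (ord3E j) => ->.
Qed.

Lemma heis_mx_inj x y w x' y' w' : heis_mx x y w = heis_mx x' y' w' ->
  [/\ x = x', y = y' & w = w'].
Proof.
move=> /matrixP E; have := (E 0 1, E 1 2, E 0 2).
by rewrite !mxE /= => -[[-> ->] ->].
Qed.

Lemma mxcomm_heis x y w x' y' w' :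
  mxcomm (heis_mx x y w) (heis_mx x' y' w') = heis_mx 0 0 (x * y' - x' * y).
Proof.
apply/matrixP => i j; rewrite /mxcomm !mxE !sum3E !mxE.
by case: (ord3E i) => ->; case: (ord3E j) => -> /=; ring.
Qed.

(** The bracket is [a, b] = t <z, a x b> z.  With linear forms p, q, r as
coordinates on heis_3, the commutator has the central coordinate
<p x q, a x b>, so p, q have to vanish on z and t r(z) z to be p x q.  The choices
p = z_i e_(i+1) - z_(i+1) e_i, q = z_i e_(i+2) - z_(i+2) e_i satisfy
p x q = z_i z, whence r = e_i / t. *)
Lemma iso_heis3_of_rank1 t z (i : 'I_3) : t != 0 -> z i != 0 ->
  (forall l k, M l k = t * z l * z k) -> iso_heis3 G.
Proof.
move=> t0 zi ME.
pose Phi a := heis_mx (z i * a (i + 1) - z (i + 1) * a i)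
  (z i * a (i + 2) - z (i + 2) * a i) (t^-1 * a i).
have t1 : t^-1 != 0 by rewrite invr_eq0.
have ordi (P : 'I_3 -> Prop) : P i -> P (i + 1) -> P (i + 2) -> forall k, P k.
  by case: (ord3E i) => ->; rewrite ?ord3D => p q r k; case: (ord3E k) => ->.
apply: (lie_isomorphic_coords (Phi := Phi)).
- by move=> a; apply/heis3P; do 3! eexists.
- move=> a b /heis_mx_inj[e1 e2 /(mulfI t1) e0].
  rewrite e0 in e1 e2; apply/funext; apply: ordi => //.
    by apply: (mulfI zi); apply: (addIr (- (z (i + 1) * b i))).
  by apply: (mulfI zi); apply: (addIr (- (z (i + 2) * b i))).
- move=> w /heis3P[x [y [r ->]]].
  exists (fun k => if k == i then t * r else if k == i + 1 then
    (z i)^-1 * (x + z (i + 1) * (t * r)) else (z i)^-1 * (y + z (i + 2) * (t * r))).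
  have n1 : (i + 1 == i) = false by case: (ord3E i) => ->; rewrite ?ord3D.
  have n2 : (i + 2 == i) = false by case: (ord3E i) => ->; rewrite ?ord3D.
  have n3 : (i + 2 == i + 1) = false by case: (ord3E i) => ->; rewrite ?ord3D.
  rewrite /Phi n1 n2 n3 !eqxx; congr heis_mx; by field.
- move=> a b; apply/matrixP => j k; rewrite !mxE.
  by case: (ord3E j) => ->; case: (ord3E k) => -> /=; ring.
- move=> u a; apply/matrixP => j k; rewrite !mxE.
  by case: (ord3E j) => ->; case: (ord3E k) => -> /=; ring.
- move=> a b; rewrite /Phi mxcomm_heis.
  congr heis_mx; rewrite !sum3E !ME /cross; move: zi.
  + by case: (ord3E i) => ->; rewrite !ord3D => zi; field.
  + by case: (ord3E i) => ->; rewrite !ord3D => zi; field.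
  + by case: (ord3E i) => ->; rewrite !ord3D => zi; field.
Qed.

(** Let z correspond to E_02.  All brackets are multiples of z, so the rows of M are
s_l z; and z is central, so z x s = 0 and s is a multiple of z. *)
Lemma rank1_of_iso_heis3 : iso_heis3 G ->
  exists t z, [/\ t != 0, exists i : 'I_3, z i != 0 &
    forall l k, M l k = t * z l * z k].
Proof.
have laP := lie_algebraP g_riemannian g_left_invariant e_frame.
case=> phi [[phi_fun phi_inj phi_surj] phiD phiZ phi_br].
have lafc a : lie_algebra (fc a) by apply/laP; exists a.
have inj X Y : lie_algebra X -> lie_algebra Y -> phi X = phi Y -> X = Y.
  by move=> lX lY; apply: phi_inj; rewrite inE.
have surj x y w : exists a, phi (fc a) = heis_mx x y w.
  have /phi_surj[X /laP[a ->] <-] : @heis3 R (heis_mx x y w).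
    by apply/heis3P; exists x, y, w.
  by exists a.
have [[ax phix] [ay phiy] [z phiz]] := And3 (surj 1 0 0) (surj 0 1 0) (surj 0 0 1).
have lbr a b : lie_algebra (bracket (fc a) (fc b)).
  exact: (lie_algebra_bracket (lafc a) (lafc b)).
have z_spans a b : exists r, bracket (fc a) (fc b) = fc (fun k => r * z k).
  have /heis3P[x [y [w pa]]] := phi_fun _ (lafc a).
  have /heis3P[x' [y' [w' pb]]] := phi_fun _ (lafc b).
  exists (x * y' - x' * y); apply: inj => //.
  rewrite phi_br // pa pb mxcomm_heis -frame_combZ phiZ // phiz.
  by apply/matrixP => i j; rewrite !mxE;
    case: (ord3E i) => ->; case: (ord3E j) => -> /=; ring.
have z_central a : bracket (fc z) (fc a) = 0.
  have /heis3P[x [y [w pa]]] := phi_fun _ (lafc a).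
  rewrite -frame_comb0; apply: inj => //.
  have -> : (fun=> 0) = (fun k : 'I_3 => 0 * 0 : R).
    by apply/funext => k; rewrite mulr0.
  rewrite -(frame_combZ 0 (fun=> 0)) phiZ // scale0r phi_br // phiz pa mxcomm_heis.
  by apply/matrixP => i j; rewrite !mxE;
    case: (ord3E i) => ->; case: (ord3E j) => -> /=; ring.
have brxy : bracket (fc ax) (fc ay) = fc z.
  apply: inj => //; rewrite phi_br // phix phiy phiz mxcomm_heis.
  by congr heis_mx; ring.
have z_neq0 : exists i, z i != 0.
  apply: contrapT => /forallNP z0.
  have zE : z = (fun k => 0 * z k).
    by apply/funext => k; have /negP := z0 k; rewrite negbK mul0r => /eqP.
  have : phi (fc z) = 0 *: phi (fc z) by rewrite {1}zE -frame_combZ phiZ.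
  rewrite scale0r phiz => /matrixP /(_ 0 2); rewrite !mxE /= => /eqP.
  by rewrite oner_eq0.
have [i zi] := z_neq0.
have rowE l : exists r, forall k, M l k = r * z k.
  have [r] := z_spans (fun k => (k == l + 1)%:R) (fun k => (k == l + 2)%:R).
  rewrite !frame_comb_delta (bracket_frame g_riemannian) // => /frame_comb_inj E.
  by exists r.
pose s l := M l i / z i.
have ME l k : M l k = s l * z k.
  by have [r rE] := rowE l; rewrite /s !rE mulfK.
have sz l k : s l * z k = s k * z l.
  have central a : \sum_l cross z a l * s l = 0.
    have := z_central a.
    rewrite bracket_cross -frame_comb0 => /frame_comb_inj /(_ i).
    under eq_bigr do rewrite ME mulrA.
    by rewrite -mulr_suml => /eqP; rewrite mulf_eq0 (negbTE zi) orbF => /eqP.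
  have := (central (fun k => (k == 0)%:R), central (fun k => (k == 1)%:R),
    central (fun k => (k == 2)%:R)).
  rewrite !sum3E /cross !ord3D !eqxx !ord3_eqE /= => -[[c0 c1] c2].
  by case: (ord3E l) => ->; case: (ord3E k) => ->; lra.
exists (s i / z i), z; split.
- apply/negP => /eqP t0.
  have s0 l : s l = 0.
    by apply: (mulIf zi); rewrite sz -[s i](divfK zi) t0 !mul0r.
  have : fc z = 0 by rewrite -brxy; apply: bracket_eq0 => l k; rewrite ME s0 mul0r.
  by rewrite -frame_comb0 => /frame_comb_inj /(_ i) /eqP; rewrite (negbTE zi).
- by exists i.
- move=> l k; rewrite ME; congr (_ * _).
  by apply: (mulIf zi); rewrite sz; field.
Qed.

Lemma milnor_frame_self t : (forall l k, M l k = t * (l == k)%:R) ->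
  milnor_frame g e e t t t.
Proof.
move=> ME.
have br l : bracket (e (l + 1)) (e (l + 2)) = cscale t (e l).
  rewrite (bracket_frame g_riemannian) // -(frame_comb_delta l) frame_combZ.
  by congr (fc _); apply/funext => k; rewrite -[LHS]/(M l k) ME eq_sym.
have := (br 0, br 1, br 2); rewrite !ord3D => -[[b0 b1] b2].
split=> //; split=> // x; rewrite (_ : \matrix_(i, j) _ = 1%:M) ?det1 //.
by apply/matrixP => i j; rewrite !mxE (frame_orthonormal e_frame).
Qed.

Lemma gfun_frame_comb2 a b x : gfun g (fc a) (fc b) x = \sum_k a k * b k.
Proof.
have vfc a' := vfield_frame_comb e_frame a'.
rewrite (gfunC g_riemannian) //.
have vc k : vfield (cscale (b k) (e k)).
  by apply: vfield_cscale; exact: (frame_vfield e_frame).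
rewrite {1}/frame_comb (gfun_sum g_riemannian) //; apply: eq_bigr => k _.
have ve := frame_vfield e_frame k.
rewrite (gfunZ g_riemannian) // (gfunC g_riemannian) //.
by rewrite (gfun_frame_comb g_riemannian) // mulrC.
Qed.

(** The rows of a rotation form a positive orthonormal basis, so each is the cross
product of the next two: the matrix of these cross products, times O^T, is
det(O) I by expansion. *)
Lemma rotation_cross (O : 'M[R]_3) : O *m O^T = 1%:M -> 0 < \det O ->
  \matrix_(i, l) cross (O (i + 1)) (O (i + 2)) l = O.
Proof.
move=> orth detO_gt0.
have detO : \det O = 1.
  have : \det O * \det O = 1 by rewrite -{2}det_tr -det_mulmx orth det1.
  nra.
set C := \matrix_(i, l) _.
have CO : C *m O^T = 1%:M.
  rewrite -detO det_mx33; apply/matrixP => i j; rewrite mxE sum3E !mxE /cross.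
  by case: (ord3E i) => ->; case: (ord3E j) => ->; rewrite !ord3D /=; ring.
by rewrite -[C]mulmx1 -(mulmx1C orth) mulmxA CO mul1mx.
Qed.

(** A rotation commutes with the cross product, so that the relation
[X, Y] = t (X x Y) does not depend on the positive orthonormal frame. *)
Lemma scalar_of_milnor_frame f t : milnor_frame g e f t t t ->
  forall l k, M l k = t * (l == k)%:R.
Proof.
case=> -[f_frame f_orient] br0 br1 br2.
pose O : 'M[R]_3 := \matrix_(i, j) g 1%g (f i 1%g) (e j 1%g).
have laP := lie_algebraP g_riemannian g_left_invariant e_frame.
have fE i : f i = fc (O i).
  have [lf _ _] := f_frame; have /laP[a fa] := lf i.
  rewrite fa; congr (fc _); apply/funext => k; rewrite mxE fa.
  by rewrite -[RHS]/(gfun g (fc a) (e k) 1%g) (gfun_frame_comb g_riemannian).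
have orth : O *m O^T = 1%:M.
  apply/matrixP => i j; have [_ /(_ i j 1%g) fij _] := f_frame.
  rewrite [RHS]mxE -fij -[RHS]/(gfun g (f i) (f j) 1%g) !fE gfun_frame_comb2.
  by rewrite [LHS]mxE; apply: eq_bigr => k _; rewrite [X in _ * X = _]mxE.
have CE := rotation_cross orth (f_orient 1%g).
set C := (X in X = O) in CE.
have fbr i : bracket (f (i + 1)) (f (i + 2)) = cscale t (f i).
  by case: (ord3E i) => ->; rewrite !ord3D.
pose Mm : 'M[R]_3 := \matrix_(l, k) M l k.
have OM : O *m Mm = t *: O.
  rewrite -{1}CE; apply/matrixP => i k; rewrite [LHS]mxE [RHS]mxE.
  have := fbr i; rewrite !fE bracket_cross frame_combZ => /frame_comb_inj /(_ k).
  by move=> <-; apply: eq_bigr => l _; rewrite [C _ _]mxE [Mm _ _]mxE.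
have ME : Mm = t%:M.
  rewrite -[Mm]mul1mx -(mulmx1C orth) -mulmxA OM -scalemxAr.
  by rewrite (mulmx1C orth) scalemx1.
by move=> l k; have /matrixP /(_ l k) := ME; rewrite !mxE mulr_natr.
Qed.

End LieAlgebra.

(** * The three families of Ricci Killing spinors *)

Section MainLemmas.
Variables (R : realType) (G : lieGroup3 R) (g : metric G).
Variables (nabla : field G -> field G -> field G) (e : 'I_3 -> field G).
Hypotheses (g_riemannian : riemannian g)
  (g_left_invariant : left_invariant_metric g).
Hypothesis nabla_levi_civita : levi_civita g nabla.
Hypothesis e_frame : left_invariant_onframe g e.
Local Notation c := (struct_cst g e).
Local Notation M := (cross_mx c).
Let c_skew := struct_cst_skew g_riemannian g_left_invariant e_frame.
Implicit Type s : 'cV[R[i]]_2.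

Let rkP := ricci_killing_cst g_riemannian g_left_invariant nabla_levi_civita e_frame.
Let kP := killing_cst g_riemannian g_left_invariant nabla_levi_civita e_frame.

Lemma commutative_ricci_killing s : s != 0 -> commutative_algebra G ->
  parallel g nabla e (fun=> s) /\ ricci_killing g nabla e (fun=> s).
Proof.
move=> s0 /(commutative_algebraP g_riemannian g_left_invariant e_frame) M0.
have ME l k : M l k = 0 * (l == k)%:R by rewrite M0 mul0r.
have rot0 k l : conn_mx c k l = 0 by rewrite (conn_mx_scalar c_skew ME) !mul0r.
split; first exact: parallel_cst.
exists 1; apply/rkP => //; split=> [|k l]; first exact: oner_neq0.
by rewrite rot0 (koszul_ricci_scalar c_skew ME) expr0n !mul0r mulr0.
Qed.

Lemma su2_ricci_killing s f t : s != 0 -> milnor_frame g e f t t t -> t != 0 ->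
  ricci_killing_with g nabla e (2 * t)^-1 (fun=> s) /\
  killing_with g nabla e (t / 4) (fun=> s).
Proof.
move=> s0 f_milnor t0.
have ME := scalar_of_milnor_frame g_riemannian g_left_invariant e_frame f_milnor.
have rotE := conn_mx_scalar c_skew ME.
split.
  apply/rkP => //; split=> [|k l].
    by rewrite invr_eq0 mulf_neq0 // pnatr_eq0.
  by rewrite rotE (koszul_ricci_scalar c_skew ME); field.
by apply/kP => // k l; rewrite rotE; field.
Qed.

Lemma heis3_ricci_killing s : s != 0 -> iso_heis3 G ->
  ricci_killing g nabla e (fun=> s) /\ ~ killing g nabla e (fun=> s).
Proof.
move=> s0 /(rank1_of_iso_heis3 g_riemannian g_left_invariant e_frame).
case=> t [z [t0 [i zi] ME]]; split; last first.
  case=> kappa /kP => /(_ s0) rotE.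
  exact: (conn_mx_rank1_nscalar c_skew ME t0 zi rotE).
have z2 : \sum_k z k ^+ 2 != 0.
  rewrite gt_eqF // (bigD1 i) //= ltr_pwDl ?exprn_even_gt0 //.
  by apply: sumr_ge0 => k _; exact: sqr_ge0.
have n0 : t * \sum_k z k ^+ 2 != 0 by rewrite mulf_neq0.
(* Ric = - t |z|^2 W. *)
exists (- (2 * (t * \sum_k z k ^+ 2))^-1); apply/rkP => //; split=> [|k l].
  by rewrite oppr_eq0 invr_eq0 mulf_neq0 // pnatr_eq0.
by rewrite (koszul_ricci_rank1 c_skew ME); field; rewrite t0 z2.
Qed.

End MainLemmas.

Theorem theorem5p2 (R : realType) (G : lieGroup3 R)
    (g : metric G) (nabla : field G -> field G -> field G)
    (e : 'I_3 -> field G)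
    (G_connected : connected [set: G])
    (g_riemannian : riemannian g)
    (g_left_invariant : left_invariant_metric g)
    (nabla_levi_civita : levi_civita g nabla)
    (e_frame : left_invariant_onframe g e) :
  [/\ (exists psi, invariant_spinor psi /\ ricci_killing g nabla e psi) <->
        [\/ commutative_algebra G,
            iso_su2 G /\
              (exists f l, milnor_frame g e f l l l /\ l != 0) |
            iso_heis3 G],
      commutative_algebra G ->
        forall psi : spinor G, invariant_spinor psi -> nonzero psi ->
          parallel g nabla e psi /\ ricci_killing g nabla e psi,
      iso_su2 G -> forall f l, milnor_frame g e f l l l -> l != 0 ->
        forall psi : spinor G, invariant_spinor psi -> nonzero psi ->
          ricci_killing_with g nabla e (2 * l)^-1 psi /\
          killing_with g nabla e (l / 4) psi &
      iso_heis3 G ->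
        forall psi : spinor G, invariant_spinor psi -> nonzero psi ->
          ricci_killing g nabla e psi /\ ~ killing g nabla e psi].
Proof.
have c_skew := struct_cst_skew g_riemannian g_left_invariant e_frame.
have invP (psi : spinor G) : invariant_spinor psi -> nonzero psi ->
    exists2 s, s != 0 & psi = (fun=> s).
  by case=> s -> [x s0]; exists s.
have comm psi : commutative_algebra G -> invariant_spinor psi -> nonzero psi ->
    parallel g nabla e psi /\ ricci_killing g nabla e psi.
  move=> cG ipsi npsi; have [s s0 ->] := invP _ ipsi npsi.
  exact: commutative_ricci_killing.
have su2 psi f l : milnor_frame g e f l l l -> l != 0 ->
    invariant_spinor psi -> nonzero psi ->
    ricci_killing_with g nabla e (2 * l)^-1 psi /\
    killing_with g nabla e (l / 4) psi.
  move=> fl l0 ipsi npsi; have [s s0 ->] := invP _ ipsi npsi.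
  exact: su2_ricci_killing fl l0.
have heis psi : iso_heis3 G -> invariant_spinor psi -> nonzero psi ->
    ricci_killing g nabla e psi /\ ~ killing g nabla e psi.
  move=> hG ipsi npsi; have [s s0 ->] := invP _ ipsi npsi.
  exact: heis3_ricci_killing.
split; [split|by move=> cG psi; exact: comm|
  by move=> _ f l fl l0 psi; exact: su2 fl l0|by move=> hG psi; exact: heis].
- case=> psi [ipsi [mu rk]]; have npsi : nonzero psi by case: rk.
  have [s s0 psiE] := invP _ ipsi npsi; move: rk; rewrite psiE.
  move=> /(ricci_killing_cst g_riemannian g_left_invariant nabla_levi_civita
    e_frame).
  case=> // mu0 rk.
  have J := struct_cst_jacobi g_riemannian g_left_invariant e_frame.
  have [M0|[l l0 ME]|[t [z [t0 [i zi] ME]]]] :=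
    ricci_killing_classification c_skew J mu0 rk.
  + constructor 1.
    exact/(commutative_algebraP g_riemannian g_left_invariant e_frame).
  + constructor 2; split.
      exact: (iso_su2_of_scalar g_riemannian g_left_invariant e_frame l0 ME).
    by exists e, l; split=> //; exact: milnor_frame_self.
  + constructor 3.
    exact: (iso_heis3_of_rank1 g_riemannian g_left_invariant e_frame t0 zi ME).
- have n1 : (const_mx 1 : 'cV[R[i]]_2) != 0.
    by apply/eqP => /matrixP /(_ 0 0); rewrite !mxE => /eqP; rewrite oner_eq0.
  have ipsi : invariant_spinor (fun _ : G => const_mx 1 : 'cV[R[i]]_2).
    by exists (const_mx 1).
  have npsi : nonzero (fun _ : G => const_mx 1 : 'cV[R[i]]_2) by exists 1%g.
  move=> cases; exists (fun=> const_mx 1); split=> //.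
  case: cases => [cG|[_ [f [l [fl l0]]]]|hG].
  + by have [] := comm _ cG ipsi npsi.
  + by exists (2 * l)^-1; have [] := su2 _ f l fl l0 ipsi npsi.
  + by have [] := heis _ hG ipsi npsi.
Qed.
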